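(* Let $\Omega\subset\mathbb R^n$ be a bounded open set, $1<p<\infty$, let $\theta:\overline\Omega\to\mathbb R$ be Lipschitz on $\overline\Omega$, and let $a<b$. Suppose that there exist measurable functions $\Gamma_-,\Gamma_+:[a,b]\to[0,\infty)$ and $m,M:[a,b]\to[0,\infty)$ such that \[ \Gamma_-(\theta(x))\le|\nabla\theta(x)|\le\Gamma_+(\theta(x))\qquad\text{for a.e. }x\in\{x\in\Omega:a\le\theta(x)\le b\}, \] and \[ m(t)\le S_\theta(t)\le M(t)\qquad\text{for a.e. }t\in(a,b). \] Then, for almost every $t\in(a,b)$, \[ \Gamma_-(t)^{p-1}m(t)\le A_{p,\theta}(t)\le\Gamma_+(t)^{p-1}M(t). \] If in addition the integrals involved are finite, one has \[ \left(\int_a^b\left(\Gamma_-(t)^{p-1}m(t)\right)^{-\frac1{p-1}}\,\mathrm{d}t\right)^{1-p}\le\operatorname{cap}_{p,\theta}(a,b) \] and \[ \operatorname{cap}_{p,\theta}(a,b)\le\left(\int_a^b\left(\Gamma_+(t)^{p-1}M(t)\right)^{-\frac1{p-1}}\,\mathrm{d}t\right)^{1-p}. \]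
   Context: For $t\in\mathbb R$ let $\Sigma_t=\{x\in\Omega:\theta(x)=t\}$ and $S_\theta(t)=\mathcal H^{n-1}(\Sigma_t\cap\Omega)$. The energy weight is defined for almost every $t$ by \[A_{p,\theta}(t)=\int_{\Sigma_t\cap\Omega}|\nabla\theta|^{p-1}\,\mathrm{d}\mathcal H^{n-1},\] with $\nabla\theta$ the almost everywhere defined gradient (by the coarea formula it is defined $\mathcal H^{n-1}$-a.e. on $\Sigma_t$ for a.e. $t$). Negative powers of $0$ are $+\infty$. For $v\in W^{1,1}(a,b)$ (absolutely continuous representative on $[a,b]$) set $\mathcal E_{p,\theta}(v;a,b)=\int_a^b|v'(t)|^pA_{p,\theta}(t)\,\mathrm{d}t\in[0,+\infty]$, and \[\operatorname{cap}_{p,\theta}(a,b)=\inf\{\mathcal E_{p,\theta}(v;a,b): v\in W^{1,1}(a,b),\ v(a)=0,\ v(b)=1,\ \mathcal E_{p,\theta}(v;a,b)<\infty\}.\] *)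

(* Defs.v *)
From HB Require Import structures.
From mathcomp Require Import all_boot all_order all_algebra.
From mathcomp Require Import all_classical all_reals all_analysis.

Set Implicit Arguments.
Unset Strict Implicit.
Unset Printing Implicit Defensive.
Import Order.TTheory GRing.Theory Num.Theory.
Import numFieldNormedType.Exports.

Local Open Scope classical_set_scope.
Local Open Scope ring_scope.

(* The library norm of 'rV[R]_n is the sup norm. *)
Definition enorm (R : realType) (n : nat) (x : 'rV[R]_n) : R :=
  Num.sqrt (\sum_i x 0 i ^+ 2).

(* Total; only meaningful where f is differentiable, hence almost everywhere for
   a locally Lipschitz f, by Rademacher's theorem. *)
Definition gradient (R : realType) (n : nat) (f : 'rV[R]_n -> R)
    (x : 'rV[R]_n) : 'rV[R]_n :=
  \row_i 'D_(delta_mx 0 i) f x.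

Definition ediam (R : realType) (n : nat) (C : set 'rV[R]_n) : \bar R :=
  ereal_sup [set (enorm (x - y))%:E | x in C & y in C].

(* Volume pi^(k/2) / Gamma(k/2 + 1) of the unit ball of R^k. *)
Fixpoint ball_volume (R : realType) (k : nat) : R :=
  match k with
  | 0 => 1
  | 1 => 2
  | k'.+2 => 2 * pi / k%:R * ball_volume R k'
  end.

(* The empty set is treated separately because of the convention 0 ^+ 0 = 1. *)
Definition hausdorff_gauge (R : realType) (n k : nat) (C : set 'rV[R]_n) :
    \bar R :=
  if C == set0 then 0%E
  else (ball_volume R k * (fine (ediam C) / 2) ^+ k)%:E.

Definition hausdorff_delta (R : realType) (n k : nat) (delta : R)
    (X : set 'rV[R]_n) : \bar R :=
  ereal_inf [set (\sum_(j <oo) hausdorff_gauge k (C j))%E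
            | C in [set C : (set 'rV[R]_n)^nat |
                     (forall j, (ediam (C j) <= delta%:E)%E) /\
                     X `<=` \bigcup_j C j]].

Definition hausdorff (R : realType) (n k : nat) (X : set 'rV[R]_n) : \bar R :=
  ereal_sup [set hausdorff_delta k delta X | delta in [set d : R | 0 < d]].
Arguments hausdorff : clear implicits.

Section hausdorff_is_outer_measure.
Context (R : realType) (n k : nat).
Implicit Types X : set 'rV[R]_n.
Local Open Scope ereal_scope.

Lemma ball_volume_ge0 j : (0 <= ball_volume R j)%R.
Proof.
suff: (0 <= ball_volume R j)%R && (0 <= ball_volume R j.+1)%R by case/andP.
elim: j => [|j /andP[h0 h1]]; first by rewrite /= ler01 ler0n.
rewrite h1 /= mulr_ge0 // divr_ge0 // mulr_ge0 //; exact: pi_ge0.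
Qed.

Lemma ediam0 : ediam (@set0 'rV[R]_n) = -oo.
Proof.
rewrite /ediam (_ : [set _ | _ in _ & _ in _] = set0) ?ereal_sup0//.
by apply/seteqP; split => // z [x].
Qed.

Lemma ediam_ge0 X : X !=set0 -> 0 <= ediam X.
Proof.
move=> [x Xx]; apply: ereal_sup_ubound; exists x => //; exists x => //.
rewrite subrr /enorm big1 ?sqrtr0 // => i _.
by rewrite mxE expr0n.
Qed.

Lemma hausdorff_gauge0 : hausdorff_gauge k (@set0 'rV[R]_n) = 0.
Proof. by rewrite /hausdorff_gauge eqxx. Qed.

Lemma hausdorff_gauge_ge0 X : 0 <= hausdorff_gauge k X.
Proof.
rewrite /hausdorff_gauge; case: ifPn => // /set0P X0.
rewrite lee_fin mulr_ge0 ?ball_volume_ge0 // exprn_ge0 // divr_ge0 //.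
exact/fine_ge0/ediam_ge0.
Qed.

Let cut (delta : R) X := if ediam X <= delta%:E then hausdorff_gauge k X else +oo.

Let cut_ge0 delta X : 0 <= cut delta X.
Proof. by rewrite /cut; case: ifPn => // _; exact: hausdorff_gauge_ge0. Qed.

Let cut0 delta : cut delta set0 = 0.
Proof. by rewrite /cut ediam0 leNye hausdorff_gauge0. Qed.

Let hausdorff_deltaE delta : hausdorff_delta k delta =
  @mu_ext _ (g_sigma_algebraType [set: set 'rV[R]_n]) R (cut delta).
Proof.
apply/funext => X; apply/eqP; rewrite eq_le; apply/andP; split.
- apply: le_ereal_inf_tmp => _ [C [_ XC] <-].
  have [dC|/existsNP[j /negP dC]] :=
    pselect (forall j, ediam (C j) <= delta%:E).
    apply: ereal_inf_lbound; exists C => //.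
    by apply: eq_eseriesr => j _; rewrite /cut dC.
  rewrite (@eseries_pinfty _ _ predT j) ?leey// => [i _|].
    by rewrite -ltNye (lt_le_trans _ (cut_ge0 _ _)).
  by rewrite /cut (negbTE dC).
- apply: le_ereal_inf_tmp => _ [C [dC XC] <-].
  apply: ereal_inf_lbound; exists C.
    by split => // j; apply: sub_sigma_algebra.
  by apply: eq_eseriesr => j _; rewrite /cut dC.
Qed.

Lemma hausdorff0 : hausdorff R n k set0 = 0.
Proof.
rewrite /hausdorff (_ : [set _ | _ in _] = [set 0]) ?ereal_sup1//.
apply/seteqP; split => [_ [d _ <-]|_ ->] /=.
  by rewrite hausdorff_deltaE mu_ext0// => Y; exact: cut_ge0.
by exists 1%R => //=; rewrite hausdorff_deltaE mu_ext0// => Y; exact: cut_ge0.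
Qed.

Lemma hausdorff_ge0 X : 0 <= hausdorff R n k X.
Proof.
apply: (@le_trans _ _ (hausdorff_delta k 1 X)).
  by rewrite hausdorff_deltaE; apply: mu_ext_ge0 => Y; exact: cut_ge0.
by apply: ereal_sup_ubound; exists 1%R => /=.
Qed.

Lemma le_hausdorff : {homo hausdorff R n k : X Y / X `<=` Y >-> X <= Y}.
Proof.
move=> X Y XY; apply: ge_ereal_sup => _ [d d0 <-].
apply: (@le_trans _ _ (hausdorff_delta k d Y)).
  by rewrite hausdorff_deltaE; exact: le_mu_ext.
by apply: ereal_sup_ubound; exists d.
Qed.

Lemma hausdorff_sigma_subadditive : sigma_subadditive (hausdorff R n k).
Proof.
move=> F; apply: ge_ereal_sup => _ [d d0 <-].
rewrite hausdorff_deltaE; apply: le_trans.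
  by apply: mu_ext_sigma_subadditive => Y; exact: cut_ge0.
apply: lee_nneseries => i _ ; first by move=> _; apply: mu_ext_ge0 => Y; exact: cut_ge0.
by apply: ereal_sup_ubound; exists d => //; rewrite hausdorff_deltaE.
Qed.

HB.instance Definition _ := isOuterMeasure.Build R 'rV[R]_n (hausdorff R n k)
  hausdorff0 hausdorff_ge0 le_hausdorff hausdorff_sigma_subadditive.

End hausdorff_is_outer_measure.

Definition hausdorff_outer_measure (R : realType) (n k : nat) :
    {outer_measure set 'rV[R]_n -> \bar R} :=
  hausdorff R n k.

Definition hausdorff_measure (R : realType) (n k : nat) :
    {measure set (caratheodory_type (hausdorff_outer_measure R n k)) -> \bar R} :=
  (hausdorff_outer_measure R n k :
    set (caratheodory_type (hausdorff_outer_measure R n k)) -> \bar R).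

Definition closed_box (R : realType) (n : nat) (I : 'rV[R]_n * 'rV[R]_n) :
    set 'rV[R]_n :=
  [set x | forall i, I.1 0 i <= x 0 i <= I.2 0 i].

Definition lebesgue_outer (R : realType) (n : nat) (X : set 'rV[R]_n) :
    \bar R :=
  ereal_inf [set (\sum_(j <oo) (\prod_i ((I j).2 0 i - (I j).1 0 i))%:E)%E
            | I in [set I : ('rV[R]_n * 'rV[R]_n)^nat |
                     (forall j i, (I j).1 0 i <= (I j).2 0 i) /\
                     X `<=` \bigcup_j closed_box (I j)]].

(* P holds at Lebesgue-almost every point of D. *)
Definition ae_in (R : realType) (n : nat) (D P : set 'rV[R]_n) : Prop :=
  lebesgue_outer (D `\` P) = 0%E.

(* Lebesgue measure on the line, on the complete sigma-algebra of Lebesgue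
   measurable sets (the library's lebesgue_measure lives on the Borel sets). *)
Notation leb := (@completed_lebesgue_measure _).

Definition lebesgue_measurable_fun (R : realType) (D : set R) (f : R -> R) :=
  @measurable_fun _ _ (caratheodory_type (mu_ext (@wlength R idfun)))
    (measurableTypeR R) D f.

(* x^(-r) for r > 0, with 0^(-r) = +oo and (+oo)^(-r) = 0; the library has
   0 `^ (- r) = 0. *)
Definition neg_powe (R : realType) (x : \bar R) (r : R) : \bar R :=
  ((x `^ r)^-1)%E.

Definition abs_continuous (R : realType) (a b : R) (v : R -> R) : Prop :=
  forall e : R, 0 < e -> exists2 d : R, 0 < d &
    forall (k : nat) (x y : 'I_k -> R),
      (forall i, a <= x i /\ x i <= y i /\ y i <= b) ->
      trivIset setT (fun i => `]x i, y i[%classic) ->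
      \sum_i (y i - x i) < d ->
      \sum_i `|v (y i) - v (x i)| < e.

Definition C1_compact_support (R : realType) (a b : R) (phi : R -> R) : Prop :=
  [/\ forall t, derivable phi t 1,
      continuous (derive1 phi) &
      exists c d : R, [/\ a < c, d < b &
        forall t, t \notin `[c, d] -> phi t = 0]].

(* Elements of W^{1,1}(a, b), given by their absolutely continuous
   representative on [a, b] together with (a version of) the weak derivative.
   Test functions are C^1 with compact support in ]a, b[. *)
Record W11 (R : realType) (a b : R) := {
  W11_fun :> R -> R ;
  W11_deriv : R -> R ;
  W11_abs_continuous : abs_continuous a b W11_fun ;
  W11_integrable : leb.-integrable `]a, b[ (EFin \o W11_fun) ;
  W11_deriv_integrable : leb.-integrable `]a, b[ (EFin \o W11_deriv) ;
  W11_weak_deriv : forall phi, C1_compact_support a b phi ->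
    \int[leb]_(t in `]a, b[) (W11_fun t * derive1 phi t) =
    - \int[leb]_(t in `]a, b[) (W11_deriv t * phi t) }.

Section energy.
Context (R : realType) (n : nat).
Variables (p : R) (Omega : set 'rV[R]_n) (theta : 'rV[R]_n -> R).
Local Open Scope ereal_scope.

Definition level_set (t : R) : set 'rV[R]_n :=
  [set x | Omega x /\ theta x = t].

Definition level_area (t : R) : \bar R := hausdorff R n n.-1 (level_set t).

Definition energy_weight (t : R) : \bar R :=
  \int[hausdorff_measure R n n.-1]_(x in level_set t)
    (enorm (gradient theta x) `^ (p - 1))%:E.

Definition energy (a b : R) (v : W11 a b) : \bar R :=
  \int[leb]_(t in `]a, b[) ((`|W11_deriv v t| `^ p)%:E * energy_weight t).

Definition capacity (a b : R) : \bar R :=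
  ereal_inf [set energy v
            | v in [set v : W11 a b | [/\ v a = 0%R, v b = 1%R &
                                          energy v < +oo]]].

End energy.

(* Main.v *)
(* The energy weight is bounded on a level set as soon as the bounds of the
   gradient hold H^(n-1)-almost everywhere on it.  For almost every level they
   do: a Lebesgue null set N is covered by cubes of side s with small total
   volume, a cube meets the levels of a set of measure O(s) only, in sets of
   H^(n-1)-premeasure O(s^(n-1)), so the premeasures of the slices of N have
   arbitrarily small integral.

   For a weight W > 0 put K = W^(-1/(p-1)) and let J be the integral of K over
   ]a, b[.  The minimal energy is attained by the primitive of K / J, which gives
   the upper bound.  For the lower bound, Young's inequality gives
   p c^(p-1) |v'| <= |v'|^p W + (p-1) c^p K with c = 1 / J; integrating, together
   with v(b) - v(a) = 1, yields J^(1-p) <= energy. *)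
Require Import Defs.
From HB Require Import structures.
From mathcomp Require Import all_boot all_order all_algebra.
From mathcomp Require Import all_classical all_reals all_analysis measurable_realfun.
From mathcomp Require Import ring lra.

Set Implicit Arguments.
Unset Strict Implicit.
Unset Printing Implicit Defensive.
Import Order.TTheory GRing.Theory Num.Theory.
Import numFieldNormedType.Exports.

Local Open Scope classical_set_scope.
Local Open Scope ring_scope.

(** * Comparison of integrals without measurability *)

(** No measurability is available for [energy_weight] as a function of the level, nor for the
    gradient on a level set with respect to Hausdorff measure. Comparisons therefore use that the
    integral of a nonnegative function is a lower integral, and additivity is used only once the
    energy weight has been replaced by a measurable [W]. The null set where the gradient bounds fail
    may contain whole levels; it is sliced at a fixed scale of the premeasure, where measurable
    majorants of small integral can be written down. Elements of W^{1,1} carry only a weak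
    derivative: that its integral is v(b) - v(a) is proved by testing, and that the minimiser
    belongs to the class is proved by Fubini. Finiteness of J forces W > 0 almost everywhere, hence
    also J > 0. With c = 1 / J, Young's inequality is an equality exactly when |v'| = c K, so both
    bounds have the same form c^(p-1) = J^(1-p). *)

Section ae_comparison.
Context d (T : measurableType d) (R : realType) (mu : {measure set T -> \bar R}).
Local Open Scope ereal_scope.
Import HBNNSimple.

(* The integral of a nonnegative function is a supremum over simple functions,
   hence monotone without measurability of the integrands. *)
Lemma ae_le_lower_integral (D : set T) (f g : T -> \bar R) :
  (forall x, D x -> 0 <= f x) -> (forall x, D x -> 0 <= g x) ->
  {ae mu, forall x, D x -> f x <= g x} ->
  \int[mu]_(x in D) f x <= \int[mu]_(x in D) g x.
Proof.
move=> f0 g0 [N [mN N0 fgN]].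
rewrite !ge0_integralE//; apply: ge_ereal_sup => _ [h /= hf <-].
have mNC : measurable (~` N) by exact: measurableC.
(* Cutting [h] off on the null set [N] does not change its integral and brings it below [g]
   everywhere; only simple functions need to be measurable. *)
have hE : (h \_ (~` N))%R = proj_nnsfun h mNC by exact: mrestrict.
apply: le_ereal_sup_tmp; exists (sintegral mu (proj_nnsfun h mNC)).
  exists (proj_nnsfun h mNC) => // x; rewrite -hE patchE.
  case: ifPn => [/set_mem Nx|_]; last first.
    by rewrite patchE; case: ifPn => // /set_mem /g0.
  apply: le_trans (hf x) _; rewrite !patchE.
  case: ifPn => // /set_mem Dx; apply: contrapT => fgx.
  by apply: Nx; apply: fgN => /= /(_ Dx).
rewrite -!integralT_nnsfun; apply: ae_ge0_le_integral => //.
- by move=> x _; rewrite lee_fin.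
- exact/measurable_EFinP.
- by move=> x _; rewrite lee_fin.
- exact/measurable_EFinP.
exists N; split => // x; apply: contra_notP => Nx _.
by rewrite -hE patchE mem_set.
Qed.

Lemma le_lower_integral (D : set T) (f g : T -> \bar R) :
  (forall x, D x -> 0 <= f x) -> (forall x, D x -> f x <= g x) ->
  \int[mu]_(x in D) f x <= \int[mu]_(x in D) g x.
Proof.
move=> f0 fg; apply: ae_le_lower_integral => //; last exact: aeW.
by move=> x Dx; rewrite (le_trans (f0 _ Dx))// fg.
Qed.

End ae_comparison.

(** * Borel sets are Hausdorff measurable *)

Section euclidean_norm.
Context (R : realType) (n : nat).
Implicit Types x : 'rV[R]_n.

Lemma enorm_ge0 x : 0 <= enorm x.
Proof. exact: sqrtr_ge0. Qed.

Lemma normr_le_enorm x : `|x| <= enorm x.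
Proof.
have [x0|/mx_norm_neq0[[i j] /= xij]] := eqVneq (mx_norm x) 0.
  by have -> : `|x| = 0 := x0; exact: enorm_ge0.
have {xij} -> : `|x| = `|x 0 j| by rewrite (ord1 i) in xij.
rewrite -sqrtr_sqr ler_sqrt; last by apply: sumr_ge0 => k _; exact: sqr_ge0.
by rewrite (bigD1 j)//= lerDl sumr_ge0// => k _; exact: sqr_ge0.
Qed.

(** The sharp factor is sqrt(n); only the order O(s) of the diameter of a cube of side [s] matters
    later. *)
Lemma enorm_le_coord x s : 0 <= s -> (forall i, `|x 0 i| <= s) ->
  enorm x <= n%:R * s.
Proof.
move=> s0 xs; rewrite -[leRHS]ger0_norm ?mulr_ge0// -sqrtr_sqr ler_sqrt ?sqr_ge0//.
apply: (@le_trans _ _ (\sum_(i < n) s ^+ 2)).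
  by apply: ler_sum => i _; rewrite -real_normK ?num_real// lerXn2r ?nnegrE.
rewrite sumr_const card_ord -[leLHS]mulr_natl exprMn ler_wpM2r ?sqr_ge0//.
by rewrite -natrX ler_nat; case: (n) => // k; rewrite expnS expn1 leq_pmulr.
Qed.

End euclidean_norm.

Section hausdorff_delta.
Context (R : realType) (n k : nat).
Implicit Types X Y : set 'rV[R]_n.
Local Open Scope ereal_scope.

Lemma hausdorff_delta_ge0 d X : 0 <= hausdorff_delta k d X.
Proof.
apply: le_ereal_inf_tmp => _ [C _ <-]; apply: nneseries_ge0 => j _ _.
exact: hausdorff_gauge_ge0.
Qed.

Lemma le_hausdorff_delta d X Y : X `<=` Y ->
  hausdorff_delta k d X <= hausdorff_delta k d Y.
Proof.
move=> XY; apply: ereal_inf_le_tmp => _ [C [dC YC] <-].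
by exists C => //; split => //; exact: subset_trans YC.
Qed.

Lemma hausdorff_delta_anti d d' X : (d <= d')%R ->
  hausdorff_delta k d' X <= hausdorff_delta k d X.
Proof.
move=> dd'; apply: ereal_inf_le_tmp => _ [C [dC XC] <-]; exists C => //.
by split => // j; rewrite (le_trans (dC j))// lee_fin.
Qed.

(** A set of diameter at most [d < r] cannot meet both [X] and [Y], so a cover of the union splits
    into a cover of [X] and a disjoint family covering [Y]. *)
Lemma hausdorff_delta_separated (d r : R) X Y : (0 < d)%R -> (d < r)%R ->
  (forall x y, X x -> Y y -> (r <= enorm (x - y))%R) ->
  hausdorff_delta k d X + hausdorff_delta k d Y
    <= hausdorff_delta k d (X `|` Y).
Proof.
move=> d0 dr sepXY; apply: le_ereal_inf_tmp => _ [C [dC XYC] <-].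
(* Covering sets that miss [Z] are replaced by the empty set, whose gauge is 0. *)
pose trace Z j := if pselect (exists2 x, Z x & C j x) then C j else set0.
have trace_cover Z : Z `<=` X `|` Y ->
    hausdorff_delta k d Z <= \sum_(j <oo) hausdorff_gauge k (trace Z j).
  move=> ZXY; apply: ereal_inf_lbound; exists (trace Z) => //; split.
    by move=> j; rewrite /trace; case: pselect => [?|?]; rewrite ?ediam0 ?leNye ?dC.
  move=> x Zx; have [j _ Cjx] := XYC _ (ZXY _ Zx); exists j => //.
  by rewrite /trace; case: pselect => // -[]; exists x.
apply: le_trans (leeD (trace_cover X _) (trace_cover Y _)) _.
- by move=> x; left.
- by move=> x; right.
rewrite -nneseriesD//; do ?by move=> *; exact: hausdorff_gauge_ge0.
apply: lee_nneseries => [j _ _|j _].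
  by rewrite adde_ge0 ?hausdorff_gauge_ge0.
rewrite /trace; case: pselect => [[x Xx Cx]|_] /=; last first.
  rewrite hausdorff_gauge0 add0e; case: pselect => //= _.
  by rewrite hausdorff_gauge0 hausdorff_gauge_ge0.
case: pselect => [[y Yy Cy]|_] /=; last by rewrite hausdorff_gauge0 adde0.
have : (enorm (x - y))%:E <= d%:E.
  by apply: le_trans (dC j); apply: ereal_sup_ubound; exists x => //; exists y.
by rewrite lee_fin => /(le_trans (sepXY _ _ Xx Yy)); rewrite leNgt dr.
Qed.

(* [hausdorff_delta] is the outer measure generated by the gauge truncated to
   sets of diameter at most [d]. *)
Lemma hausdorff_delta_sigma_subadditive d :
  sigma_subadditive (hausdorff_delta k d : set 'rV[R]_n -> \bar R).
Proof.
pose cut (X : set 'rV[R]_n) :=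
  if ediam X <= d%:E then hausdorff_gauge k X else +oo.
have cut_ge0 X : 0 <= cut X.
  by rewrite /cut; case: ifPn => // _; exact: hausdorff_gauge_ge0.
suff: hausdorff_delta k d =
    @mu_ext _ (g_sigma_algebraType [set: set 'rV[R]_n]) R cut.
  by move=> -> F; apply: mu_ext_sigma_subadditive => Y; exact: cut_ge0.
apply/funext => X; apply/eqP; rewrite eq_le; apply/andP; split.
- apply: le_ereal_inf_tmp => _ [C [_ XC] <-].
  have [dC|/existsNP[j /negP dC]] := pselect (forall j, ediam (C j) <= d%:E).
    apply: ereal_inf_lbound; exists C => //.
    by apply: eq_eseriesr => j _; rewrite /cut dC.
  rewrite [leRHS](@eseries_pinfty _ _ predT j) ?leey//.
    by move=> i _; rewrite -ltNye (lt_le_trans _ (cut_ge0 _)).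
  by rewrite /cut (negbTE dC).
- apply: le_ereal_inf_tmp => _ [C [dC XC] <-]; apply: ereal_inf_lbound.
  exists C; first by split => // j; exact: sub_sigma_algebra.
  by apply: eq_eseriesr => j _; rewrite /cut dC.
Qed.

End hausdorff_delta.

Section hausdorff_borel.
Context (R : realType) (n k : nat).
Implicit Types X Y F : set 'rV[R]_n.
Local Notation H := (hausdorff R n k).
Local Open Scope ereal_scope.

(** Additivity at all small scales passes to the supremum. The two suprema are taken one after the
    other by subtraction, which is why the infinite case is split off. *)
Lemma hausdorff_separated (r : R) X Y : (0 < r)%R ->
  (forall x y, X x -> Y y -> (r <= enorm (x - y))%R) ->
  H X + H Y <= H (X `|` Y).
Proof.
move=> r0 sepXY.
have [->|HXYfin] := eqVneq (H (X `|` Y)) +oo; first by rewrite leey.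
have fin Z : Z `<=` X `|` Y -> H Z \is a fin_num.
  move=> ZXY; rewrite ge0_fin_numE ?hausdorff_ge0//.
  by rewrite (le_lt_trans (le_hausdorff _ ZXY))// ltey.
rewrite -leeBrDr; last by apply: fin; right.
apply: ge_ereal_sup => _ [d1 /= d10 <-].
have fin1 : hausdorff_delta k d1 X \is a fin_num.
  rewrite ge0_fin_numE ?hausdorff_delta_ge0//.
  apply: (@le_lt_trans _ _ (H X)); last first.
    by rewrite -ge0_fin_numE ?hausdorff_ge0// fin// => x; left.
  by apply: ereal_sup_ubound; exists d1.
rewrite leeBrDr; last by apply: fin; right.
rewrite -leeBrDl//; apply: ge_ereal_sup => _ [d2 /= d20 <-].
(* Shrinking the scale only increases both premeasures, and [r / 2] keeps it strictly below the
   separation. *)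
rewrite leeBrDl//; pose d := Num.min (r / 2)%R (Num.min d1 d2).
have d0 : (0 < d)%R by rewrite !lt_min divr_gt0// d10.
apply: (@le_trans _ _ (hausdorff_delta k d X + hausdorff_delta k d Y)).
  apply: leeD; apply: hausdorff_delta_anti.
    by rewrite !ge_min lexx orbT.
  by rewrite !ge_min lexx !orbT.
apply: le_trans (@hausdorff_delta_separated _ _ _ d r _ _ d0 _ sepXY) _.
  by rewrite !gt_min ltr_pdivrMr// ltr_pMr// ltr1n.
by apply: ereal_sup_ubound; exists d.
Qed.

(* With [A j] the points of [X] at distance at least [1 / (j + 1)] from [F], the
   sets [A j] and [A j.+2 `\` A j.+1] are separated; hence the measures of the
   layers [A j.+1 `\` A j] are bounded by telescoping differences. *)
Lemma closed_caratheodory_hausdorff F : closed F -> H.-caratheodory F.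
Proof.
move=> cF; apply: (@le_caratheodory_measurable _ _ (hausdorff_outer_measure R n k)).
move=> X; rewrite /hausdorff_outer_measure/=.
have [->|HXfin] := eqVneq (H X) +oo; first by rewrite leey.
(* Distances to [F] are in the sup norm; being below [enorm], it yields the Euclidean separation
   that diameters require. *)
pose A j := [set x | X x /\ forall y, F y -> (j.+1%:R^-1 <= `|x - y|)%R].
pose B j := A j.+1 `\` A j.
have AX j : H (A j) <= H X by apply: le_hausdorff => x [].
have ABle j : H (A j) + H (B j.+1) <= H (A j.+2).
  pose r : R := (j.+1%:R^-1 - j.+2%:R^-1)%R.
  apply: (@le_trans _ _ (H (A j `|` B j.+1))); last first.
    apply: le_hausdorff => x [[Xx xF]|[]//]; split => // y Fy.
    by apply: le_trans (xF _ Fy); rewrite lef_pV2 ?posrE// ler_nat ltnW.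
  apply: (@hausdorff_separated r).
    by rewrite subr_gt0 ltf_pV2 ?posrE// ltr_nat.
  move=> x z [Xx xF] [[Xz _] zF]; apply: le_trans (normr_le_enorm _).
  have [y Fy zy] : exists2 y, F y & (`|z - y| < j.+2%:R^-1)%R.
    apply: contrapT => noy; apply: zF; split => // y Fy; rewrite leNgt.
    by apply/negP => zy; apply: noy; exists y.
  rewrite /r lerBlDr; apply: le_trans (xF _ Fy) _.
  by rewrite -(subrKA z) (le_trans (ler_normD _ _))// lerD2l ltW.
(* Each new layer [B m.+1] is absorbed by [A m] into [A m.+2]; two consecutive terms suffice since
   only layers of the same parity are separated. *)
have Bsum m : \sum_(0 <= j < m.+1) H (B j) <= H (A m) + H (A m.+1).
  elim: m => [|m IH].
    rewrite big_nat1; apply: (@le_trans _ _ (H (A 1%N))).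
      by apply: le_hausdorff => x [].
    by rewrite leeDr// hausdorff_ge0.
  rewrite big_nat_recr//= (le_trans (leeD IH (lexx _)))//.
  by rewrite addeAC addeC leeD2l.
have Bfin : \sum_(0 <= j <oo) H (B j) < +oo.
  apply: (@le_lt_trans _ _ (H X + H X)); last by rewrite lte_add_pinfty// ltey.
  apply: lime_le; first by apply: is_cvg_nneseries => *; exact: hausdorff_ge0.
  apply: nearW => -[|m].
    by rewrite big_geq// adde_ge0// hausdorff_ge0.
  by rewrite (le_trans (Bsum m))// leeD.
have /fine_cvgP[] := nneseries_tail_cvg Bfin (fun j _ => hausdorff_ge0 k (B j)).
move=> fin_tail /cvgrPdist_lt tail0; apply/lee_addgt0Pr => e e0.
near \oo => N.
have te : \sum_(N <= j <oo) H (B j) <= e%:E.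
  have tfin : \sum_(N <= j <oo) H (B j) \is a fin_num by near: N.
  rewrite -(fineK tfin) lee_fin (le_trans (ler_norm _))//.
  by rewrite -normrN -sub0r ltW//; near: N; exact: tail0.
(* Closedness of [F] puts a point of [X] off [F] in some [A m]; descending from [m], it lies in
   [A N] or in a layer of index at least [N]. *)
have XCF : X `&` ~` F `<=` A N `|` \bigcup_(j in ~` `I_N) B j.
  move=> x [Xx Fx]; have [m xm] : exists m, A m x.
    have /nbhs_normP[s /= s0 sF] : nbhs x (~` F).
      by apply: open_nbhs_nbhs; split => //; exact: closed_openC.
    exists (Num.bound s^-1); split => // y Fy; rewrite leNgt; apply/negP => xy.
    apply: (sF y) => //; apply: lt_le_trans xy _.
    rewrite -[leRHS]invrK lef_pV2 ?posrE ?invr_gt0//.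
    have sV0 : (0 <= s^-1)%R by rewrite invr_ge0 ltW.
    by rewrite (le_trans (ltW (archi_boundP sV0)))// ler_nat.
  elim: m xm => [|m IH] xm.
    left; case: xm => _ xF; split => // y /xF; apply: le_trans.
    by rewrite lef_pV2 ?posrE// ler_nat.
  have [/IH//|nxm] := pselect (A m x).
  have [mN|Nm] := ltnP m N.
    left; case: xm => _ xF; split => // y /xF; apply: le_trans.
    by rewrite lef_pV2 ?posrE// ler_nat.
  by right; exists m => //=; apply/negP; rewrite -leqNgt.
apply: (@le_trans _ _ (H (X `&` F) + (H (A N) + e%:E))).
  apply: leeD2l; apply: le_trans (le_hausdorff _ XCF) _.
  apply: le_trans (outer_measureU2 (hausdorff_outer_measure R n k) _ _) _.
  apply: leeD2l; apply: le_trans te.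
  exact: (outer_measure_sigma_subadditive_tail (hausdorff_outer_measure R n k)).
rewrite addeA; apply: leeD2r.
apply: (@le_trans _ _ (H ((X `&` F) `|` A N))); last first.
  by apply: le_hausdorff => x [[]|[]].
rewrite addeC setUC; apply: (@hausdorff_separated N.+1%:R^-1).
  by rewrite invr_gt0.
by move=> x y [_ xF] [_ Fy]; apply: le_trans (normr_le_enorm _); exact: xF.
Unshelve. all: by end_near. Qed.

End hausdorff_borel.

(** * Slices of Lebesgue null sets *)

(* The carrier of [leb], convertible to [R], whose own measurable sets are only
   the Borel sets. *)
Notation lebT R := (caratheodory_type (mu_ext (@wlength R idfun))).

Section completed_lebesgue.
Context (R : realType).
Implicit Types (A : set R) (a b : R).

Lemma borel_lebT A : @measurable _ (measurableTypeR R) A ->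
  @measurable _ (lebT R) A.
Proof. by move=> mA; exact: sub_caratheodory. Qed.

#[global] Instance leb_ae_filter :
  Filter (almost_everywhere (@completed_lebesgue_measure R)).
Proof. exact: (@ae_filter_ringOfSetsType _ (lebT R)). Qed.

Lemma leb_itv (b0 b1 : bool) a b : a <= b ->
  leb [set` Interval (BSide b0 a) (BSide b1 b)] = (b - a)%:E.
Proof.
move=> ab; rewrite (_ : leb _ = @lebesgue_measure R
  [set` Interval (BSide b0 a) (BSide b1 b)])//.
rewrite lebesgue_measure_itv/= lte_fin; case: ltgtP ab => // -> _.
by rewrite subrr.
Qed.

End completed_lebesgue.

Section hausdorff_delta_outer.
Context (R : realType) (n k : nat) (d : R).
Local Notation Hd := (hausdorff_delta k d : set 'rV[R]_n -> \bar R).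
Local Open Scope ereal_scope.

Lemma hausdorff_delta_gauge (X : set 'rV[R]_n) : ediam X <= d%:E ->
  Hd X <= hausdorff_gauge k X.
Proof.
move=> dX; pose C (j : nat) : set 'rV[R]_n := if j is 0%N then X else set0.
rewrite (_ : hausdorff_gauge k X = \sum_(j <oo) hausdorff_gauge k (C j)).
  apply: ereal_inf_lbound; exists C => //; split; last by move=> x; exists 0%N.
  by case => //= _; rewrite ediam0 leNye.
rewrite nneseries_recl//; last by move=> *; exact: hausdorff_gauge_ge0.
rewrite eseries_cond eseries0 ?adde0// => -[|j]//= _ _.
exact: hausdorff_gauge0.
Qed.

Lemma hausdorff_delta0 : Hd set0 = 0.
Proof.
apply/eqP; rewrite eq_le hausdorff_delta_ge0 andbT.
by rewrite -(hausdorff_gauge0 R n k) hausdorff_delta_gauge// ediam0 leNye.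
Qed.

(** At a fixed scale the premeasure is already an outer measure, so finite subadditivity is
    available when a slice is cut into cubes. *)
HB.instance Definition _ := isOuterMeasure.Build R 'rV[R]_n Hd
  hausdorff_delta0 (@hausdorff_delta_ge0 R n k d) (@le_hausdorff_delta R n k d)
  (@hausdorff_delta_sigma_subadditive R n k d).

End hausdorff_delta_outer.

Lemma outer_measure_bigsetU (R : realType) T
    (mu : {outer_measure set T -> \bar R}) (I : Type) (s : seq I) (P : pred I)
    (F : I -> set T) :
  (mu (\big[setU/set0]_(i <- s | P i) F i) <= \sum_(i <- s | P i) mu (F i))%E.
Proof.
elim/big_ind2 : _ => //; first by rewrite outer_measure0.
by move=> X x Y y Xx Yy; rewrite (le_trans (outer_measureU2 _ _ _))// leeD.
Qed.

Section small_majorants.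
Context d (T : measurableType d) (R : realType) (mu : {measure set T -> \bar R}).
Local Open Scope ereal_scope.

(** The infimum of majorants with integrals at most 1 / (k + 1) is measurable and has integral 0,
    hence vanishes almost everywhere; [u] itself need not be measurable. *)
Lemma ae_eq0_small_majorants (u : T -> \bar R) : (forall x, 0 <= u x) ->
  (forall e : R, (0 < e)%R -> exists g : T -> \bar R,
    [/\ measurable_fun setT g, forall x, 0 <= g x, forall x, u x <= g x &
       \int[mu]_x g x <= e%:E]) ->
  {ae mu, forall x, u x = 0}.
Proof.
move=> u0 small.
have /choice[G GP] (k : nat) : exists g : T -> \bar R,
    [/\ measurable_fun setT g, forall x, 0 <= g x, forall x, u x <= g x &
       \int[mu]_x g x <= (k.+1%:R^-1)%:E].
  by apply: small; rewrite invr_gt0.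
pose F x := einfs (G ^~ x) 0%N.
have mF : measurable_fun setT F.
  by apply: measurable_fun_einfs => k; have [] := GP k.
have F0 x : 0 <= F x.
  by apply: le_ereal_inf_tmp => _ [k _ <-]; have [] := GP k.
have uF x : u x <= F x.
  by apply: le_ereal_inf_tmp => _ [k _ <-]; have [] := GP k.
have FG k x : F x <= G k x by apply: ereal_inf_lbound; exists k.
have intF : \int[mu]_x F x = 0.
  apply/eqP; rewrite eq_le integral_ge0// andbT.
  apply/lee_addgt0Pr => e e0; rewrite add0e.
  have eV0 : (0 <= e^-1)%R by rewrite invr_ge0 ltW.
  pose k := Num.bound e^-1; have [mG G0 _ Ge] := GP k.
  apply: (@le_trans _ _ (\int[mu]_x G k x)); first exact: ge0_le_integral.
  apply: (le_trans Ge); rewrite lee_fin -[leRHS]invrK.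
  rewrite lef_pV2 ?posrE ?invr_gt0//.
  by rewrite (le_trans (ltW (archi_boundP eV0)))// ler_nat.
have : \int[mu]_x `|F x| = 0.
  by rewrite -[RHS]intF; apply: eq_integral => x _; rewrite gee0_abs.
move=> /(ae_eq_integral_abs mu measurableT mF); apply: filterS => x /(_ I) Fx0.
by apply/eqP; rewrite eq_le u0 andbT -[leRHS]Fx0 uF.
Qed.

End small_majorants.

(** * Covering the slices of a null set by cubes *)

Section slices.
Context (R : realType) (n : nat) (n_gt0 : (0 < n)%N).
Variables (N : set 'rV[R]_n) (theta : 'rV[R]_n -> R) (L : R).
Hypothesis L_ge0 : 0 <= L.
Hypothesis theta_lip :
  forall x y, N x -> N y -> `|theta x - theta y| <= L * `|x - y|.

(** A cube of side [s] has gauge at most [ball_volume R n.-1 * (n s)^(n-1)] and meets levels in an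
    interval of length [2 L s]; the product of the two is [C s^n]. *)
Let C : R := ball_volume R n.-1 * n%:R ^+ n.-1 * (2 * L).

Let C_ge0 : 0 <= C.
Proof. by rewrite /C !mulr_ge0// ?ball_volume_ge0 ?exprn_ge0. Qed.

Let slice t := N `&` [set x | theta x = t].

(** The product is a polynomial in [s], hence continuous at 0. The excess [e] pays for rounding the
    sides of a box up to multiples of [s], also when the box is degenerate. *)
Lemma prod_side_approx (l : 'I_n -> R) (e d : R) : 0 < e -> 0 < d ->
  exists s, [/\ 0 < s, s <= d & \prod_i (l i + s) <= \prod_i l i + e].
Proof.
move=> e0 d0; pose p : {poly R} := \prod_i ('X + (l i)%:P).
have pE s : p.[s] = \prod_i (l i + s).
  by rewrite horner_prod; apply: eq_bigr => i _; rewrite !hornerE addrC.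
have : p.[s] @[s --> 0^'+] --> p.[0].
  by apply: cvg_at_right_filter; exact: continuous_horner.
move=> /cvgrPdist_le /(_ _ e0) near_p.
near (0 : R)^'+ => s; exists s; split.
- by near: s; exact: nbhs_right_gt.
- by near: s; exact: nbhs_right_le.
rewrite -pE -lerBlDl; have -> : \prod_i l i = p.[0].
  by rewrite pE; apply: eq_bigr => i _; rewrite addr0.
by rewrite (le_trans (ler_norm _))// distrC; near: s.
Unshelve. all: by end_near. Qed.

Local Open Scope ereal_scope.

Lemma hausdorff_delta_cube (s d : R) (X : set 'rV[R]_n) :
  (0 <= s)%R -> (n%:R * s <= d)%R ->
  (forall x y i, X x -> X y -> (`|(x - y) 0 i| <= s)%R) ->
  hausdorff_delta n.-1 d X
    <= (ball_volume R n.-1 * n%:R ^+ n.-1 * s ^+ n.-1)%:E.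
Proof.
move=> s0 sd Xs; have dX : ediam X <= (n%:R * s)%:E.
  apply: ge_ereal_sup => _ [x Xx [y Xy <-]]; rewrite lee_fin.
  by apply: enorm_le_coord => // i; exact: Xs.
apply: le_trans (hausdorff_delta_gauge _ _) _.
  by rewrite (le_trans dX)// lee_fin.
rewrite /hausdorff_gauge; case: ifPn => [_|/set0P X0].
  by rewrite lee_fin !mulr_ge0 ?ball_volume_ge0 ?exprn_ge0.
have dX0 := ediam_ge0 X0.
have dXfin : ediam X \is a fin_num.
  by rewrite ge0_fin_numE// (le_lt_trans dX) ?ltry.
rewrite lee_fin -mulrA ler_wpM2l ?ball_volume_ge0// -exprMn lerXn2r ?nnegrE//.
- by rewrite divr_ge0 ?fine_ge0.
- by rewrite mulr_ge0.
have := fine_le dXfin (erefl : (n%:R * s)%:E \is a fin_num) dX.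
move=> /=; apply: le_trans; rewrite ler_pdivrMr// ler_peMr ?fine_ge0//.
by rewrite ler1n.
Qed.

(** The box is cut into cubes of side [s], and [g] adds for each cube the bound of its premeasure on
    an interval containing all levels that the cube meets. The integral of [g] is at most [C] times
    the total volume of the cubes. *)
Lemma slice_box (I : 'rV[R]_n * 'rV[R]_n) (d e : R) :
  (forall i, (I.1 0 i <= I.2 0 i)%R) -> (0 < d)%R -> (0 < e)%R ->
  exists g : lebT R -> \bar R, [/\ measurable_fun setT g, forall t, 0 <= g t,
    (forall t, hausdorff_delta n.-1 d (slice t `&` closed_box I) <= g t) &
    \int[leb]_t g t <= (C * (\prod_i (I.2 0 i - I.1 0 i) + e))%:E].
Proof.
move=> I12 d0 e0.
have nR0 : (0 < n%:R :> R)%R by rewrite ltr0n.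
have [s [s0 sd sI]] := prod_side_approx (fun i => I.2 0 i - I.1 0 i)%R e0
  (divr_gt0 d0 nR0).
rewrite ler_pdivlMr// mulrC in sd.
(* Indices run over [0, ..., m i], so that a point of the far face is also covered; [K] is a common
   bound giving one finite type of indices, and [F] below selects the relevant ones. *)
pose m i := Num.truncn ((I.2 0 i - I.1 0 i) / s)%R.
pose K := (\max_i m i).+1.
pose Q (f : {ffun 'I_n -> 'I_K}) : set 'rV[R]_n :=
  [set x | forall i, (I.1 0 i + (f i)%:R * s <= x 0 i <= I.1 0 i + (f i).+1%:R * s)%R].
(* The centre is the level of a chosen point of [N] in the cube, as [theta] is Lipschitz on [N]
   only; the radius is [L * s] because the sup-norm diameter of a cube is at most [s]. *)
pose J (f : {ffun 'I_n -> 'I_K}) : set R :=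
  if pselect (exists x, N x /\ Q f x) is left h then
    `[(theta (sval (cid h)) - L * s)%R, (theta (sval (cid h)) + L * s)%R]%classic
  else set0.
have mJ f : @measurable _ (lebT R) (J f).
  by apply: borel_lebT; rewrite /J; case: pselect => [h|h] /=.
pose F := family (fun i : 'I_n => [pred j : 'I_K | (j < (m i).+1)%N]).
pose c : R := (ball_volume R n.-1 * n%:R ^+ n.-1 * s ^+ n.-1)%R.
have c0 : (0 <= c)%R by rewrite !mulr_ge0 ?ball_volume_ge0 ?exprn_ge0// ltW.
pose g (t : lebT R) := \sum_(f <- enum F) (c%:E * (\1_(J f) t)%:E).
have Qs f x y i : Q f x -> Q f y -> (`|(x - y) 0 i| <= s)%R.
  move=> /(_ i) /andP[x1 x2] /(_ i) /andP[y1 y2]; rewrite !mxE.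
  rewrite -natr1 mulrDl mul1r in x2 y2; rewrite ler_norml; apply/andP; split.
    by rewrite lerNl opprB; lra.
  by lra.
exists g; split.
- apply: emeasurable_sum => f; apply: measurable_funeM.
  exact/measurable_EFinP/measurable_indic.
- by move=> t; apply: sume_ge0 => f _; rewrite mule_ge0 ?lee_fin.
- move=> t.
  have boxQ : slice t `&` closed_box I `<=`
      \big[setU/set0]_(f in F) (slice t `&` Q f).
    move=> x [tx Ix]; have xI i : (0 <= (x 0 i - I.1 0 i) / s)%R.
      by rewrite divr_ge0 ?(ltW s0)// subr_ge0; case/andP: (Ix i).
    pose q i := Num.truncn ((x 0 i - I.1 0 i) / s)%R.
    have qm i : (q i <= m i)%N.
      apply: le_truncn; rewrite ler_pM2r ?invr_gt0// lerB//.
      by case/andP: (Ix i).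
    have qK i : (q i < K)%N by rewrite ltnS (leq_trans (qm i))// leq_bigmax.
    have qF : [ffun i => Ordinal (qK i)] \in F.
      by apply/familyP => i; rewrite ffunE inE /= ltnS.
    rewrite (bigD1 _ qF)/=; left; split => // i; rewrite ffunE /=.
    have /andP[] := truncn_itv (xI i); rewrite -/(q i).
    rewrite ler_pdivlMr// ltr_pdivrMr// => q1 q2.
    by apply/andP; split; lra.
  apply: le_trans (le_hausdorff_delta _ _ boxQ) _.
  apply: le_trans (outer_measure_bigsetU (hausdorff_delta n.-1 d) _ _ _) _.
  rewrite /g big_enum/=; apply: lee_sum => f Ff; rewrite indicE.
  have [Qt0|/set0P[x [[Nx tx] Qx]]] := eqVneq (slice t `&` Q f) set0.
    by rewrite Qt0 outer_measure0 mule_ge0 ?lee_fin.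
  rewrite mem_set ?mule1; last first.
    rewrite /J; case: pselect => [h|[]]; last by exists x.
    move: (svalP (cid h)); set z := sval _ => -[Nz Qz] /=.
    rewrite in_itv/= -ler_distlC -tx.
    apply: le_trans (theta_lip Nz Nx) _; rewrite ler_wpM2l//.
    have [->|/mx_norm_neq0[[i j] /= zxE]] := eqVneq `|z - x|%R 0%R.
      exact: ltW.
    rewrite (_ : `|z - x|%R = `|(z - x) 0 j|%R); last by rewrite (ord1 i) in zxE.
    exact: Qs Qz Qx.
  apply: hausdorff_delta_cube => //; first exact: ltW.
  by move=> x' y i [_ Qx'] [_ Qy]; exact: Qs Qx' Qy.
- have mcJ f : @measurable_fun _ _ (lebT R) _ setT
      (fun t => c%:E * (\1_(J f) t)%:E).
    by apply: measurable_funeM; exact/measurable_EFinP/measurable_indic.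
  have cJ0 f t : setT t -> 0 <= c%:E * (\1_(J f) t)%:E.
    by move=> _; rewrite mule_ge0 ?lee_fin.
  rewrite (ge0_integral_sum leb measurableT mcJ cJ0 (enum F)) big_enum/=.
  apply: (@le_trans _ _ (\sum_(f in F) (C * \prod_(i < n) s)%:E)).
    apply: lee_sum => f _.
    have m1J : @measurable_fun _ _ (lebT R) (\bar R) setT (EFin \o \1_(J f)).
      exact/measurable_EFinP/measurable_indic.
    have J0 (t : lebT R) : setT t -> 0 <= (EFin \o \1_(J f)) t :> \bar R.
      by rewrite lee_fin.
    rewrite (ge0_integralZl_EFin leb measurableT J0 m1J c0).
    rewrite integral_indic// setIT.
    apply: (@le_trans _ _ (c%:E * (2 * L * s)%:E)).
      apply: lee_wpmul2l; first by rewrite lee_fin.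
      rewrite /J; case: pselect => [h|_] /=; last first.
        by rewrite measure0 lee_fin !mulr_ge0// ltW.
      set z := theta _; have zL : (z - L * s <= z + L * s)%R.
        by rewrite lerBlDr -addrA lerDl -mulr2n mulrn_wge0// mulr_ge0// ltW.
      by rewrite leb_itv// lee_fin; lra.
    rewrite -EFinM lee_fin prodr_const card_ord /c /C.
    have -> : (s ^+ n = s ^+ n.-1 * s)%R by rewrite -exprSr prednK.
    rewrite le_eqVlt; apply/orP; left; apply/eqP; ring.
  (* The total volume of the cubes factors as the product of the [(m i + 1) s], and each factor
     exceeds the side of the box by at most [s]. *)
  rewrite sumEFin lee_fin -mulr_sumr ler_wpM2l// -(bigA_distr_big_dep _ (fun _ _ => s)).
  apply: le_trans sI; apply: ler_prod => i _.
  rewrite sumr_ge0/=; last by move=> *; exact: ltW.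
  have mK : ((m i).+1 <= K)%N by rewrite ltnS leq_bigmax.
  rewrite -(big_ord_widen _ (fun=> s) mK) sumr_const card_ord.
  rewrite -mulr_natl -natr1 mulrDl mul1r lerD2r -ler_pdivlMr//.
  by rewrite truncn_le divr_ge0 ?(ltW s0)// subr_ge0.
Qed.

(* Eilenberg's inequality in the only case needed: almost every slice of a
   Lebesgue null set is negligible. *)
Lemma ae_slice_null : lebesgue_outer N = 0 ->
  {ae leb, forall t : R, hausdorff R n n.-1 (slice t) = 0}.
Proof.
move=> N0.
have slice_delta (d : R) : (0 < d)%R ->
    {ae leb, forall t : R, hausdorff_delta n.-1 d (slice t) = 0}.
  move=> d0; apply: (@ae_eq0_small_majorants _ (lebT R)).
    by move=> t; exact: hausdorff_delta_ge0.
  (* One half is for the volume of the cover, the other for the errors [e' / 2^(j+1)]; [C + 1] is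
     positive even if [C] is 0. *)
  move=> e e0; pose e' : R := (e / (C + 1) / 2)%R.
  have C1 : (0 < C + 1)%R by rewrite ltr_pwDr.
  have e'0 : (0 < e')%R by rewrite !divr_gt0.
  have : lebesgue_outer N < e'%:E by rewrite N0 lte_fin.
  move=> /ereal_inf_lt[_ [I [I12 NI] <-]] Ie'.
  have /choice[g gP] (j : nat) : exists g : lebT R -> \bar R,
      [/\ measurable_fun setT g, forall t, 0 <= g t,
      (forall t, hausdorff_delta n.-1 d (slice t `&` closed_box (I j)) <= g t) &
      \int[leb]_t g t <= (C * (\prod_i ((I j).2 0 i - (I j).1 0 i)
                                + e' / (2 ^ j.+1)%:R))%:E].
    by apply: slice_box => //; rewrite divr_gt0// ltr0n expn_gt0.
  exists (fun t => \sum_(j <oo) g j t).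
  have g0 j t : 0 <= g j t by have [] := gP j.
  have mg j : measurable_fun setT (g j) by have [] := gP j.
  split.
  - exact: ge0_emeasurable_sum.
  - by move=> t; exact: nneseries_ge0.
  - move=> t; have NtI : slice t `<=` \bigcup_j (slice t `&` closed_box (I j)).
      by move=> x [Nx tx]; have [j _ Ijx] := NI x Nx; exists j.
    apply: le_trans (le_hausdorff_delta _ _ NtI) _.
    apply: le_trans (hausdorff_delta_sigma_subadditive n.-1 d
      (fun j => slice t `&` closed_box (I j))) _.
    apply: lee_nneseries => [j _ _|j _]; first exact: hausdorff_delta_ge0.
    by have [] := gP j.
  - rewrite integral_nneseries//.
    have prod0 j : (0 <= \prod_i ((I j).2 0 i - (I j).1 0 i))%R.
      by apply: prodr_ge0 => i _; rewrite subr_ge0.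
    apply: (@le_trans _ _ (\sum_(j <oo) (C%:E * (
        (\prod_i ((I j).2 0 i - (I j).1 0 i))%:E + (e' / (2 ^ j.+1)%:R)%:E)))).
      apply: lee_nneseries => [j _ _|j _]; first exact: integral_ge0.
      by have [_ _ _] := gP j; rewrite EFinM EFinD.
    rewrite nneseriesZl//; last first.
      move=> j _; rewrite -EFinD lee_fin addr_ge0// divr_ge0// ltW//.
    apply: (@le_trans _ _ (C%:E * (e'%:E + e'%:E))).
      apply: lee_wpmul2l; first by rewrite lee_fin.
      apply: le_trans (epsilon_trick _ _ _) _.
      + by move=> j; rewrite lee_fin.
      + exact: ltW.
      + by apply: leeD => //; exact: ltW.
    rewrite -EFinD -EFinM lee_fin /e' -splitr.
    rewrite mulrCA ler_piMr ?(ltW e0)// ler_pdivrMr// mul1r.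
    by rewrite lerDl.
(* Countably many scales suffice, since the premeasure is antitone in [d]. *)
have : {ae leb, forall t : R,
    forall k : nat, hausdorff_delta n.-1 k.+1%:R^-1 (slice t) = 0}.
  by apply: ae_foralln => k; apply: slice_delta; rewrite invr_gt0.
apply: filterS => t Ht; apply/eqP; rewrite eq_le hausdorff_ge0 andbT.
apply: ge_ereal_sup => _ [d /= d0 <-].
have dV0 : (0 <= d^-1)%R by rewrite invr_ge0 ltW.
rewrite -(Ht (Num.bound d^-1)); apply: hausdorff_delta_anti.
rewrite -[leRHS]invrK lef_pV2 ?posrE ?invr_gt0//.
by rewrite (le_trans (ltW (archi_boundP dV0)))// ler_nat.
Qed.

End slices.

(** * Bounds of the energy weight *)

Lemma lipschitz_bound (R : realType) (V W : normedModType R) (f : V -> W)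
    (A : set V) : [lipschitz f x | x in A] ->
  exists2 L, 0 <= L & forall x y, A x -> A y -> `|f x - f y| <= L * `|x - y|.
Proof.
move=> /pinfty_ex_gt0[L L0 fL]; exists L => [|x y Ax Ay]; first exact: ltW.
exact: (fL (x, y)).
Qed.

Section energy_weight_bounds.
Context (R : realType) (n : nat) (n_gt0 : (0 < n)%N).
Variables (p : R) (p_gt1 : 1 < p).
Variables (Omega : set 'rV[R]_n) (theta : 'rV[R]_n -> R).
Hypothesis Omega_open : open Omega.
Hypothesis theta_lip : [lipschitz theta x | x in closure Omega].
Local Notation H := (hausdorff_outer_measure R n n.-1).

Lemma caratheodory_null (A : set 'rV[R]_n) :
  hausdorff R n n.-1 A = 0%E -> H.-caratheodory A.
Proof.
move=> A0; apply: le_caratheodory_measurable => X.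
rewrite (_ : H (X `&` A) = 0%E) ?add0e; first exact: le_outer_measure.
apply/eqP; rewrite eq_le outer_measure_ge0 andbT -[leRHS]A0.
exact: (le_outer_measure H).
Qed.

(** Continuity of [theta] is known on the closure of [Omega] only, so the level set is closed
    relative to [Omega]: it is an open set intersected with a closed one. *)
Lemma caratheodory_level_set t : H.-caratheodory (level_set Omega theta t).
Proof.
have -> : level_set Omega theta t = Omega `&` closure (level_set Omega theta t).
  apply/seteqP; split => [x [Ox tx]|x [Ox clx]].
    by split => //; exact: subset_closure.
  split => //; have [L L0 lip] := lipschitz_bound theta_lip.
  apply/eqP; rewrite -subr_eq0 -normr_le0; apply/ler_addgt0Pr => e e0.
  have : nbhs x (ball x (e / (L + 1))).
    by apply: nbhsx_ballx; rewrite divr_gt0// ltr_pwDr.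
  move=> /clx[y [[Oy ty]]]; rewrite -ball_normE/= => xy.
  rewrite add0r -ty.
  apply: le_trans (lip _ _ (subset_closure Ox) (subset_closure Oy)) _.
  apply: (@le_trans _ _ ((L + 1) * `|x - y|)); first by rewrite ler_wpM2r// lerDl.
  by rewrite mulrC -ler_pdivlMr ?ltr_pwDr// ltW.
apply: caratheodory_measurable_setI; last first.
  exact/closed_caratheodory_hausdorff/closed_closure.
rewrite -(setCK Omega); apply: caratheodory_measurable_setC.
exact/closed_caratheodory_hausdorff/open_closedC.
Qed.

(** On the level [t] both gradient bounds are constants, so each comparison integral is a constant
    times [level_area]. *)
Lemma energy_weight_bounds (a b : R) (Gm Gp m M : R -> R) :
  (forall t, t \in `[a, b] -> 0 <= Gm t) ->
  ae_in [set x | Omega x /\ a <= theta x <= b]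
        [set x | Gm (theta x) <= enorm (gradient theta x) <= Gp (theta x)] ->
  {ae leb, forall t : R, t \in `]a, b[ ->
    ((m t)%:E <= level_area Omega theta t <= (M t)%:E)%E} ->
  {ae leb, forall t : R, t \in `]a, b[ ->
    ((Gm t `^ (p - 1) * m t)%:E <= energy_weight p Omega theta t
     <= (Gp t `^ (p - 1) * M t)%:E)%E}.
Proof.
move=> Gm0 grad area.
set D := [set x | _] in grad; set P := [set x | _] in grad.
have [L L0 lip] := lipschitz_bound theta_lip.
have lipN x y : (D `\` P) x -> (D `\` P) y ->
    `|theta x - theta y| <= L * `|x - y|.
  by move=> [[Ox _] _] [[Oy _] _]; apply: lip; exact: subset_closure.
have slices := ae_slice_null n_gt0 L0 lipN grad.
move: slices area; apply: filterS2 => t Nt0 area tab.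
have /andP[mA AM] := area tab.
have abt : a <= t <= b by move: tab; rewrite in_itv/= => /andP[/ltW -> /ltW ->].
pose lev := level_set Omega theta t.
have mlev : @measurable _ (caratheodory_type H) lev by exact: caratheodory_level_set.
have ae_lev (Q : 'rV[R]_n -> Prop) :
    (forall x, lev x -> P x -> Q x) ->
    {ae hausdorff_measure R n n.-1, forall x, lev x -> Q x}.
  move=> PQ; exists ((D `\` P) `&` [set x | theta x = t]); split.
  - exact: caratheodory_null.
  - exact: Nt0.
  - move=> x /= /not_implyP[[Ox tx] nQ]; split => //; split; first by rewrite /D/= tx.
    by move=> Px; apply: nQ; apply: PQ.
have p10 : 0 <= p - 1 by rewrite subr_ge0 ltW.
have intc (c : R) : 0 <= c ->
    (\int[hausdorff_measure R n n.-1]_(x in lev) c%:E =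
     c%:E * level_area Omega theta t)%E.
  by move=> c0; rewrite integral_cst.
apply/andP; split.
- rewrite EFinM; apply: (@le_trans _ _
    ((Gm t `^ (p - 1))%:E * level_area Omega theta t)%E).
    by apply: lee_wpmul2l => //; rewrite lee_fin powR_ge0.
  rewrite -intc ?powR_ge0//; apply: ae_le_lower_integral.
  + by move=> *; rewrite lee_fin powR_ge0.
  + by move=> *; rewrite lee_fin powR_ge0.
  + apply: ae_lev => x [_ tx] /andP[Gx _]; rewrite lee_fin -tx ge0_ler_powR//.
    * by rewrite nnegrE tx Gm0// in_itv.
    * by rewrite nnegrE enorm_ge0.
- rewrite EFinM; apply: (@le_trans _ _
    ((Gp t `^ (p - 1))%:E * level_area Omega theta t)%E); last first.
    by apply: lee_wpmul2l => //; rewrite lee_fin powR_ge0.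
  rewrite -intc ?powR_ge0//; apply: ae_le_lower_integral.
  + by move=> *; rewrite lee_fin powR_ge0.
  + by move=> *; rewrite lee_fin powR_ge0.
  + apply: ae_lev => x [_ tx] /andP[_ Gx]; rewrite lee_fin -tx ge0_ler_powR//.
    * by rewrite nnegrE enorm_ge0.
    * by rewrite nnegrE (le_trans _ Gx)// enorm_ge0.
Qed.
End energy_weight_bounds.

(** * Functions of class W11 and their boundary values *)

Section continuous_integrand.
Context (R : realType).
Implicit Types (a b x y : R) (f w : R -> R).

(** The identity pushes [leb] forward to the Borel Lebesgue measure, for which the fundamental
    theorem of calculus is stated. *)
Lemma leb_integral_borel (D : set R) (f : R -> \bar R) :
  @measurable _ (measurableTypeR R) D ->
  @measurable_fun _ _ (measurableTypeR R) _ D f ->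
  (\int[leb]_(x in D) f x = \int[@lebesgue_measure R]_(x in D) f x)%E.
Proof.
move=> mD mf; pose phi (x : lebT R) : measurableTypeR R := x.
have mphi : measurable_fun setT phi.
  by move=> _ A mA; rewrite setTI; exact: borel_lebT.
have ge0 (g : measurableTypeR R -> \bar R) : (forall x, 0 <= g x)%E ->
    measurable_fun D g ->
    (\int[leb]_(x in D) g x = \int[@lebesgue_measure R]_(x in D) g x)%E.
  move=> g0 mg.
  rewrite (eq_measure_integral (pushforward (@completed_lebesgue_measure R) phi))//.
  by rewrite (ge0_integral_pushforward mphi).
rewrite integralE [RHS]integralE; congr (_ - _)%E; apply: ge0 => //.
- exact: measurable_funepos.
- exact: measurable_funeneg.
Qed.

Lemma leb_continuous_measurable f (D : set R) : continuous f ->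
  @measurable_fun _ _ (lebT R) (measurableTypeR R) D f.
Proof.
move=> cf; apply: (@measurable_funS _ _ (lebT R) _ setT) => // _ A mA.
rewrite setTI; apply: borel_lebT; rewrite -[X in measurable X]setTI.
exact: continuous_measurable_fun.
Qed.

Lemma leb_FTC2 (F f : R -> R) a b : a < b ->
  (forall t : R, is_derive t 1 F (f t)) ->
  continuous f ->
  \int[leb]_(t in `]a, b[) f t = F b - F a.
Proof.
move=> ab dF cf; rewrite /Rintegral.
have mf (D : set R) : @measurable_fun _ _ (measurableTypeR R) _ D f.
  apply: (@measurable_funS _ _ (measurableTypeR R) _ setT) => //.
  exact: continuous_measurable_fun.
rewrite leb_integral_borel//; last exact/measurable_EFinP.
rewrite -(@integral_itv_bndoo _ a b (fun x => (f x)%:E) true false); last first.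
  by apply: (measurable_funS measurableT) => //; apply: measurableT_comp => //;
    exact: continuous_measurable_fun.
have cF : continuous F.
  by move=> t; apply/differentiable_continuous/derivable1_diffP; have [] := dF t.
rewrite (@continuous_FTC2 _ f F)//=.
- exact: continuous_subspaceT.
- split.
  + by move=> t _; have [] := dF t.
  + exact/cvg_at_right_filter/cF.
  + exact/cvg_at_left_filter/cF.
- by move=> t _; rewrite derive1E; exact: derive_val.
Qed.

Lemma continuous_itv_bounded f a b : continuous f ->
  [bounded f t | t in (`]a, b[%classic : set R)].
Proof.
move=> cf; have : bounded_set (f @` `[a, b]%classic).
  apply/compact_bounded/continuous_compact; last exact: segment_compact.
  exact: continuous_subspaceT.
move=> [M [Mr HM]]; exists M; split => // y My t tab.
apply: (HM y My); exists t => //.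
by move: tab; rewrite /= !in_itv/= => /andP[/ltW -> /ltW ->].
Qed.

Lemma leb_integrableM f w a b :
  leb.-integrable `]a, b[ (EFin \o f) -> continuous w ->
  leb.-integrable `]a, b[ (fun t => (f t * w t)%:E).
Proof.
move=> intf cw.
suff : leb.-integrable `]a, b[ ((EFin \o f) \* (EFin \o w))%E by [].
apply: integrableMl => //.
- exact: borel_lebT.
- exact: leb_continuous_measurable.
- exact: continuous_itv_bounded.
Qed.

End continuous_integrand.

(** A quadratic remainder gives the derivative of a spline without a case distinction at its
    knots. *)
Lemma is_derive_taylor (R : realType) (f : R -> R) (x l C : R) : 0 <= C ->
  (forall y, `|f y - f x - l * (y - x)| <= C * (y - x) ^+ 2) ->
  is_derive x 1 f l.
Proof.
move=> C0 fC.
have fl : h^-1 *: (f (h *: 1 + x) - f x) @[h --> 0^'] --> l.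
  apply/cvgrPdist_lt => e e0; near=> h.
  have h0 : h != 0 by near: h; exact: nbhs_dnbhs_neq.
  have hnorm : 0 < `|h| by rewrite normr_gt0.
  have -> : l - h^-1 *: (f (h *: 1 + x) - f x) =
      - (h^-1 * (f (h + x) - f x - l * (h + x - x))).
    by rewrite -[h *: 1]/(h * 1) mulr1 -[_ *: _]/(_ * _); field.
  rewrite normrN normrM normfV mulrC ltr_pdivrMr//.
  apply: le_lt_trans (fC _) _; rewrite addrK -real_normK ?num_real//.
  rewrite expr2 mulrA ltr_pM2r//.
  apply: (@le_lt_trans _ _ ((C + 1) * `|h|)); first by rewrite ler_wpM2r// lerDl.
  rewrite mulrC -ltr_pdivlMr ?ltr_wpDl//.
  near: h; apply: dnbhs0_lt; rewrite divr_gt0// ltr_wpDl//.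
by apply: DeriveDef; [apply/cvg_ex; exists l | exact: cvg_lim].
Unshelve. all: by end_near. Qed.

(** * Smooth cut-offs and averaging kernels *)

Section ramp.
Context (R : realType).
Implicit Types x y t c h : R.

Definition pos_part x := Num.max 0 x.

Lemma pos_part_taylor x y :
  `|pos_part y ^+ 2 - pos_part x ^+ 2 - 2 * pos_part x * (y - x)|
    <= (y - x) ^+ 2.
Proof.
have sx := sqr_ge0 x; have sy := sqr_ge0 y; have sxy := sqr_ge0 (y - x).
rewrite /pos_part ler_norml !maxEle.
case: (leP 0 y) => y0; case: (leP 0 x) => x0; apply/andP.
- by split; nra.
- have xy : 0 <= - x * y by rewrite mulr_ge0// oppr_ge0 ltW.
  by split; nra.
- have xy : 0 <= x * - y by rewrite mulr_ge0// oppr_ge0 ltW.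
  by split; nra.
- by split; nra.
Qed.

Lemma continuous_pos_part c : continuous (fun t => pos_part (t - c)).
Proof.
move=> t; apply: (@continuous_max _ _ (fun=> 0) (fun t => t - c)).
  exact: cvg_cst.
by apply: cvgB; [exact: cvg_id|exact: cvg_cst].
Qed.

(* A C^1 quadratic spline rising from 0 at [c] to 1 at [c + h]. *)
Definition ramp h c t := h ^- 2 *
  (2 * pos_part (t - c) ^+ 2 - 4 * pos_part (t - (c + h / 2)) ^+ 2
   + 2 * pos_part (t - (c + h)) ^+ 2).

(** For [h > 0], the hat function supported on [c, c + h], of height 2 / h and integral 1. *)
Definition dramp h c t := h ^- 2 *
  (4 * pos_part (t - c) - 8 * pos_part (t - (c + h / 2))
   + 4 * pos_part (t - (c + h))).

Lemma is_derive_ramp h c t : is_derive t 1 (ramp h c) (dramp h c t).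
Proof.
have h2 : 0 <= h ^- 2 by rewrite invr_ge0 sqr_ge0.
(* 8 = 2 + 4 + 2, the sum of the absolute coefficients of the three squares in [ramp]. *)
apply: (@is_derive_taylor _ _ _ _ (h ^- 2 * 8)); first by rewrite mulr_ge0.
move=> y; rewrite /ramp /dramp -!mulrA -!mulrBr normrM ger0_norm//.
rewrite ler_wpM2l//.
have yt d : y - t = (y - d) - (t - d) by ring.
have := pos_part_taylor (t - c) (y - c).
have := pos_part_taylor (t - (c + h / 2)) (y - (c + h / 2)).
have := pos_part_taylor (t - (c + h)) (y - (c + h)).
rewrite -!yt !ler_norml => /andP[? ?] /andP[? ?] /andP[? ?].
by apply/andP; split; lra.
Qed.

Lemma continuous_dramp h c : continuous (dramp h c).
Proof.
move=> t; apply: cvgM; first exact: cvg_cst.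
have cp k d : {for t, continuous (fun t => k * pos_part (t - d))}.
  by apply: cvgM; [exact: cvg_cst|exact: continuous_pos_part].
by apply: cvgD; [apply: cvgB|]; exact: cp.
Qed.

Lemma ramp_le0 h c t : 0 < h -> t <= c -> ramp h c t = 0.
Proof.
move=> h0 tc; rewrite /ramp /pos_part !max_l; lra.
Qed.

Lemma ramp_ge1 h c t : 0 < h -> c + h <= t -> ramp h c t = 1.
Proof.
move=> h0 tc; rewrite /ramp /pos_part !max_r; try lra.
by field; rewrite gt_eqF.
Qed.

Lemma dramp_le0 h c t : 0 < h -> t <= c -> dramp h c t = 0.
Proof.
move=> h0 tc; rewrite /dramp /pos_part !max_l; lra.
Qed.

Lemma dramp_ge1 h c t : 0 < h -> c + h <= t -> dramp h c t = 0.
Proof.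
move=> h0 tc; rewrite /dramp /pos_part !max_r; lra.
Qed.

Lemma dramp_ge0 h c t : 0 < h -> 0 <= dramp h c t.
Proof.
move=> h0; rewrite /dramp mulr_ge0 ?invr_ge0 ?sqr_ge0//.
rewrite /pos_part !maxEle; case: (leP 0 (t - c)) => ?;
  case: (leP 0 (t - (c + h / 2))) => ?; case: (leP 0 (t - (c + h))) => ?; lra.
Qed.

Lemma ramp_itv h c t : 0 < h -> 0 <= ramp h c t <= 1.
Proof.
move=> h0; have [tc|ct] := leP t c; first by rewrite ramp_le0// lexx ler01.
have [cht|tch] := leP (c + h) t; first by rewrite ramp_ge1// lexx ler01.
have h2 : 0 < h ^+ 2 by rewrite exprn_gt0.
rewrite /ramp mulrC divr_ge0 ?sqr_ge0//= ?ler_pdivrMr// ?mul1r.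
  rewrite /pos_part !maxEle; case: (leP 0 (t - c)) => ?;
  case: (leP 0 (t - (c + h / 2))) => ?; case: (leP 0 (t - (c + h))) => ?; nra.
rewrite /pos_part !maxEle; case: (leP 0 (t - c)) => ?;
case: (leP 0 (t - (c + h / 2))) => ?; case: (leP 0 (t - (c + h))) => ?; nra.
Qed.

End ramp.

Section W11_FTC.
Context (R : realType) (a b : R) (ab : a < b).
Local Notation I := (`]a, b[%classic : set R).

Let mI : @measurable _ (lebT R) I.
Proof. exact: borel_lebT. Qed.

Lemma leb_itvoo_lty : (leb I < +oo)%E.
Proof.
by rewrite leb_itv ?ltW// ltry.
Qed.

Lemma leb_continuous_integrable (w : R -> R) : continuous w ->
  leb.-integrable I (EFin \o w).
Proof.
move=> cw; apply: measurable_bounded_integrable => //.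
- exact: leb_itvoo_lty.
- exact: leb_continuous_measurable.
- exact: continuous_itv_bounded.
Qed.

(** The kernel is nonnegative, has integral 1 and lives on [c, c + h], so the integral is a weighted
    mean of the values of [v] there. *)
Lemma dramp_average (v : R -> R) (v0 c h e : R) :
  0 < h -> a <= c -> c + h <= b -> leb.-integrable I (EFin \o v) ->
  (forall t, c <= t <= c + h -> `|v t - v0| <= e) ->
  `|\int[leb]_(t in I) (v t * dramp h c t) - v0| <= e.
Proof.
move=> h0 ac chb intv ve.
have cd := @continuous_dramp R h c.
have intd (k : R) : leb.-integrable I (fun t => (k * dramp h c t)%:E).
  apply: leb_continuous_integrable => t.
  by apply: cvgM; [exact: cvg_cst|exact: cd].
have dE (k : R) : \int[leb]_(t in I) (k * dramp h c t) = k.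
  rewrite RintegralZl//; last exact: leb_continuous_integrable.
  rewrite (leb_FTC2 ab (@is_derive_ramp R h c) cd).
  by rewrite ramp_ge1// ramp_le0// subr0 mulr1.
have intvd := leb_integrableM intv cd.
have intB : leb.-integrable I
    (fun t => (v t * dramp h c t - v0 * dramp h c t)%:E).
  by have := integrableB mI intvd (intd v0); apply.
rewrite -{1}[v0]dE -RintegralB//; last exact: intd.
apply: le_trans (le_normr_Rintegral _ _) _ => //.
rewrite -[leRHS]dE; apply: le_Rintegral => //.
  exact: integrable_norm intB.
  exact: intd.
move=> t _; rewrite -mulrBl normrM [X in _ * X]ger0_norm ?dramp_ge0//.
have [tc|ct] := leP t c; first by rewrite dramp_le0// !mulr0.
have [cht|tch] := leP (c + h) t; first by rewrite dramp_ge1// !mulr0.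
by rewrite ler_wpM2r ?dramp_ge0// ve// !ltW.
Qed.

Lemma abs_continuous_lt (v : R -> R) (e : R) : abs_continuous a b v -> 0 < e ->
  exists2 d, 0 < d & forall x y, a <= x -> x <= y -> y <= b -> y - x < d ->
    `|v y - v x| < e.
Proof.
move=> /[apply] -[d d0 vd]; exists d => // x y ax xy yb yxd.
have := vd 1%N (fun=> x) (fun=> y).
rewrite !big_ord1; apply => //.
by apply/trivIsetP => i j _ _; rewrite (ord1 i) (ord1 j).
Qed.

(* Test the weak derivative against C^1 plateaus increasing to the indicator of
   [I]: their derivatives are averaging kernels at the two end points. *)
Lemma W11_FTC (v : W11 a b) : \int[leb]_(t in I) W11_deriv v t = v b - v a.
Proof.
(* With [4 h <= b - a], the plateau [phi] rises on [a + h, a + 2h] and falls on [b - 2h, b - h]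
   without overlap, and its support stays off both end points. *)
pose g := W11_deriv v; pose h (k : nat) : R := (b - a) / 4 / k.+1%:R.
have h0 k : 0 < h k by rewrite /h !divr_gt0// subr_gt0.
have h4 k : 4 * h k <= b - a.
  rewrite /h mulrA [4 * _]mulrC divfK// ler_pdivrMr ?ltr0n//.
  by rewrite ler_peMr ?ler1n// subr_ge0 ltW.
have h_cvg : h k @[k --> \oo] --> 0.
  rewrite -[X in _ --> X](mulr0 ((b - a) / 4)).
  by apply: cvgM; [exact: cvg_cst|exact: cvg_harmonic].
pose phi k t := ramp (h k) (a + h k) t - ramp (h k) (b - h k *+ 2) t.
pose dphi k t := dramp (h k) (a + h k) t - dramp (h k) (b - h k *+ 2) t.
have dphiE k (t : R) : is_derive t 1 (phi k) (dphi k t).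
  by apply: is_deriveB; exact: is_derive_ramp.
have dphi1 k : derive1 (phi k) = dphi k.
  by apply/funext => t; rewrite derive1E; exact: derive_val.
have phi_test k : C1_compact_support a b (phi k).
  have := h4 k; have := h0 k => hk0 hk4; split.
  - by move=> t; have [] := dphiE k t.
  - rewrite dphi1 => t.
    by apply: cvgB; exact: continuous_dramp.
  - exists (a + h k), (b - h k); split; rewrite ?ltrDl ?gtrDl ?oppr_lt0//.
    move=> t; rewrite in_itv/= negb_and -!ltNge /phi => /orP[ta|tb].
      by rewrite !ramp_le0 ?subrr//; lra.
    by rewrite !ramp_ge1 ?subrr//; lra.
have intv := W11_integrable v; have intg := W11_deriv_integrable v.
have lhs : \int[leb]_(t in I) (v t * dphi k t) @[k --> \oo] --> v a - v b.
  apply/cvgrPdist_le => e e0.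
  have e20 : 0 < e / 2 by rewrite divr_gt0.
  have [d d0 vd] := abs_continuous_lt (W11_abs_continuous v) e20.
  have d20 : 0 < d / 2 by rewrite divr_gt0.
  move/cvgrPdist_lt : h_cvg => /(_ _ d20); apply: filterS => k.
  rewrite sub0r normrN gtr0_norm// => hd.
  have hk4 := h4 k; have hk0 := h0 k.
  rewrite (_ : \int[leb]_(t in I) (v t * dphi k t) =
    \int[leb]_(t in I) (v t * dramp (h k) (a + h k) t) -
    \int[leb]_(t in I) (v t * dramp (h k) (b - h k *+ 2) t)); last first.
    rewrite -RintegralB//; try exact: leb_integrableM intv (@continuous_dramp _ _ _).
    by apply: eq_Rintegral => t _; rewrite mulrBr.
  have A1 : `|\int[leb]_(t in I) (v t * dramp (h k) (a + h k) t) - v a| <= e / 2.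
    apply: dramp_average => //; [lra|lra|].
    by move=> t /andP[? ?]; apply/ltW/vd; lra.
  have A2 : `|\int[leb]_(t in I) (v t * dramp (h k) (b - h k *+ 2) t) - v b| <= e / 2.
    apply: dramp_average => //; [lra|lra|].
    by move=> t /andP[? ?]; rewrite distrC; apply/ltW/vd; lra.
  rewrite -[X in `|X| <= _]opprK normrN.
  move: A1 A2; set X := \int[leb]_(t in I) _; set Y := \int[leb]_(t in I) _.
  by rewrite !ler_norml => /andP[? ?] /andP[? ?]; apply/andP; split; lra.
(* Dominated convergence: |phi| <= 1, and [phi k t] is eventually 1 at each [t] of [I]. *)
have rhs : \int[leb]_(t in I) (g t * phi k t) @[k --> \oo] -->
    \int[leb]_(t in I) g t.
  pose G k t := (g t * phi k t)%:E.
  have cphi k : continuous (phi k).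
    move=> t; apply/differentiable_continuous/derivable1_diffP.
    by have [] := dphiE k t.
  have G_cvg : {ae leb, forall t, I t -> G k t @[k --> \oo] --> (g t)%:E}.
    apply: aeW => t; rewrite /= in_itv/= => /andP[at_ tb].
    apply/cvg_EFin; first by apply: nearW.
    rewrite -[X in _ --> X]mulr1; apply: cvgM; first exact: cvg_cst.
    apply: cvg_near_cst.
    have d0 : 0 < Num.min (t - a) (b - t) / 2.
      by rewrite divr_gt0// lt_min !subr_gt0 at_.
    move/cvgrPdist_lt : h_cvg => /(_ _ d0); apply: filterS => k.
    rewrite sub0r normrN gtr0_norm// ltr_pdivlMr// lt_min => /andP[hk1 hk2].
    by rewrite /phi ramp_ge1 ?ramp_le0 ?subr0//; lra.
  have G_dom : {ae leb, forall t k, I t -> (`|G k t| <= `|(g t)%:E|)%E}.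
    apply: aeW => t k _; rewrite lee_fin normrM ler_piMr// ler_norml.
    have /andP[? ?] := ramp_itv (a + h k) t (h0 k).
    have /andP[? ?] := ramp_itv (b - h k *+ 2) t (h0 k).
    by rewrite /phi; apply/andP; split; lra.
  have mg : @measurable_fun _ _ (lebT R) _ I (EFin \o g) by have /integrableP[] := intg.
  have mG k : @measurable_fun _ _ (lebT R) _ I (G k).
    by have /integrableP[] := leb_integrableM intg (cphi k).
  have [_ _] := dominated_convergence mI mG mg G_cvg (integrable_abse intg) G_dom.
  by rewrite -(fineK (integrable_fin_num mI intg)) => /fine_cvg.
have uE k : \int[leb]_(t in I) (v t * dphi k t) =
    - \int[leb]_(t in I) (g t * phi k t).
  by rewrite -dphi1 W11_weak_deriv.
have : (- \int[leb]_(t in I) (g t * phi k t)) @[k --> \oo] -->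
    (- \int[leb]_(t in I) g t) by exact: cvgN.
under eq_fun do rewrite -uE.
move=> /(cvg_unique (@Rhausdorff R) lhs) => vg.
by rewrite -[LHS]opprK -vg opprB.
Qed.

End W11_FTC.

(** * Primitives as elements of W11 *)

Section primitive.
Context (R : realType) (k : R -> R).
Hypothesis intk : leb.-integrable setT (EFin \o k).

(** Starting at -oo avoids oriented integrals; for [k] vanishing off ]a, b[ this is the primitive
    that is 0 at [a]. *)
Let v (t : R) : R := \int[leb]_(s in (`]-oo, t[%classic : set R)) k s.

Let mk : @measurable_fun _ _ (lebT R) (measurableTypeR R) setT k.
Proof. by have /integrableP[/measurable_EFinP] := intk. Qed.

Let intkS (D : set R) : @measurable _ (measurableTypeR R) D ->
  leb.-integrable D (EFin \o k).
Proof.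
move=> mD; apply: (@integrableS _ (lebT R) _ _ setT) => //.
exact: borel_lebT.
Qed.

Lemma primitive_normB (x y : R) : x <= y ->
  `|v y - v x| <= \int[leb]_(s in (`]x, y[%classic : set R)) `|k s|.
Proof.
move=> xy.
have -> : v y = v x + \int[leb]_(s in (`[x, y[%classic : set R)) k s.
  rewrite /v -Rintegral_setU.
  - by rewrite -itv_bndbnd_setU// ?bnd_simp.
  - exact: borel_lebT.
  - exact: borel_lebT.
  - by rewrite -itv_bndbnd_setU// ?bnd_simp//; exact: intkS.
  - apply/disj_setPS => s; rewrite /= !in_itv/= => -[+ /andP[+ _]].
    by rewrite ltNge => /negP.
rewrite addrAC subrr add0r.
have [->|xny] := eqVneq x y; first by rewrite !set_itvE !Rintegral_set0 normr0.
have {xny} xy' : x < y by rewrite lt_neqAle xny.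
rewrite -(@setU1itv _ _ _ x false) ?bnd_simp// Rintegral_setU; last 4 first.
- exact: borel_lebT.
- exact: borel_lebT.
- by rewrite setU1itv ?bnd_simp//; exact: intkS.
- by apply/disj_setPS => s; rewrite /= in_itv/= => -[-> /andP[]]; rewrite ltxx.
have -> : \int[leb]_(s in [set x]) k s = 0.
  have mx : @measurable _ (lebT R) [set x] by exact: borel_lebT.
  have mkx : @measurable_fun _ _ (lebT R) _ [set x] (EFin \o k).
    by have /integrableP[] : leb.-integrable [set x] (EFin \o k) by exact: intkS.
  rewrite /Rintegral (null_set_integral mx mkx)//.
  by have := @leb_itv R true false x x (lexx x); rewrite set_itv1 subrr.
rewrite add0r; apply: le_normr_Rintegral; first exact: borel_lebT.
exact: intkS.
Qed.

(** The sum of increments is at most the integral of |k| over a union of disjoint intervals of small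
    total length. *)
Lemma primitive_abs_continuous (a b : R) : abs_continuous a b v.
Proof.
move=> e e0; have [d [d0 dk]] := integral_normr_continuous intk e0.
exists d => // n x y xy disj sumd.
have xyi i : x i <= y i by have [_ []] := xy i.
pose U := \big[setU/set0]_(i <- index_enum 'I_n) (`]x i, y i[%classic : set R).
have mxy i : @measurable _ (lebT R) (`]x i, y i[%classic : set R).
  exact: borel_lebT.
have mU : @measurable _ (lebT R) U by exact: bigsetU_measurable.
have intU : leb.-integrable U (fun s => (`|k s|)%:E).
  by apply: (@integrableS _ (lebT R) _ _ setT) => //; exact: integrable_norm.
have Ud : (leb U < d%:E)%E.
  apply: (@le_lt_trans _ _ (\sum_(i < n) (y i - x i))%:E); last by rewrite lte_fin.
  rewrite -sumEFin; apply: (@le_trans _ _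
      (\sum_(i < n) leb (`]x i, y i[%classic : set R))%E).
    exact: (outer_measure_bigsetU (mu_ext (@wlength R idfun))).
  by apply: lee_sum => i _; rewrite leb_itv.
apply: le_lt_trans (dk _ mU Ud).
apply: (@le_trans _ _ (\sum_(i < n)
    \int[leb]_(s in (`]x i, y i[%classic : set R)) `|k s|)).
  by apply: ler_sum => i _; exact: primitive_normB.
have mkU : @measurable_fun _ _ (lebT R) _ U (fun s => (`|k s|)%:E).
  by have /integrableP[] := intU.
rewrite /Rintegral (ge0_integral_bigsetU _ mxy _ _ mkU)//.
- rewrite -sum_fine// => i _.
  apply: (@integrable_fin_num _ (lebT R)) => //.
  by apply: integrable_norm; exact: intkS.
- by rewrite /index_enum -enumT enum_uniq.
- by apply: sub_trivIset disj.
Qed.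

Lemma primitive_continuous : continuous v.
Proof.
move=> x; apply/cvgrPdist_lt => e e0.
have [d [d0 dk]] := integral_normr_continuous intk e0.
have vd s t : s <= t -> t - s < d -> `|v t - v s| < e.
  move=> st tsd; apply: le_lt_trans (primitive_normB st) _.
  apply: dk; first exact: borel_lebT.
  by move: tsd; rewrite -lte_fin -(@leb_itv R false true).
near=> y; have : `|x - y| < d.
  by near: y; apply: cvgr_dist_lt.
rewrite ltr_norml => /andP[xy1 xy2]; have [xy|yx] := leP x y.
  by rewrite distrC vd//; lra.
by rewrite vd// ?ltW//; lra.
Unshelve. all: by end_near. Qed.

(** Fubini for k(s) phi'(t) on the region s < t: integrating in [t] first gives -k(s) phi(s),
    integrating in [s] first gives v(t) phi'(t). *)
Lemma primitive_weak_deriv (a b : R) (phi : R -> R) : a < b ->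
  C1_compact_support a b phi ->
  \int[leb]_(t in (`]a, b[%classic : set R)) (v t * derive1 phi t) =
  - \int[leb]_(t in (`]a, b[%classic : set R)) (k t * phi t).
Proof.
move=> ab [dphi cdphi [c [d [ac db phi0]]]].
pose I := `]a, b[%classic : set R.
have mI : @measurable _ (lebT R) I by apply: borel_lebT; exact: measurable_itv.
have dphiE (t : R) : is_derive t 1 phi (derive1 phi t).
  by rewrite derive1E; exact/derivableP/dphi.
have phi_out t : ~ I t -> phi t = 0.
  move=> It; apply: phi0; apply/negP => cdt; apply: It; rewrite /I/= in_itv/=.
  by move: cdt; rewrite in_itv/= => /andP[? ?]; apply/andP; split; lra.
pose w (t : lebT R) : R := derive1 phi t * \1_I t.
pose f (z : lebT R * lebT R) : \bar R :=
  (k z.1 * ((z.1 < z.2)%R%:R * w z.2))%:E.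
have wE : (fun t => (w t)%:E) = (EFin \o derive1 phi) \_ I.
  apply/funext => t; rewrite /w patchE indicE /=.
  by case: (t \in I); rewrite ?mulr1 ?mulr0.
have intw : leb.-integrable setT (fun t => (w t)%:E).
  rewrite wE -(@integrable_mkcond _ (lebT R))//.
  exact: leb_continuous_integrable.
(* Valid for every real [s]: left of [a] the integral runs over all of ]a, b[, and right of [b] over
   the empty set, while [phi] vanishes in both cases. *)
have tail s : (\int[leb]_t ((s < t)%R%:R * w t)%:E = (- phi s)%:E)%E.
  pose m := Num.max a s.
  have -> : (fun t : lebT R => ((s < t)%R%:R * w t)%:E) =
      (EFin \o derive1 phi) \_ (`]m, b[%classic : set R).
    apply/funext => t; rewrite patchE /w indicE /I !mem_setE !in_itv/= gt_max.
    by case: (s < t); case: (a < t); case: (t < b);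
      rewrite /= ?mulr1 ?mulr0 ?mul1r ?mul0r.
  rewrite -integral_mkcond.
  have phim : phi m = phi s.
    rewrite /m maxEle; case: (leP a s) => // sa; rewrite !phi_out// /I/= in_itv/=.
      by rewrite ltNge (ltW sa).
    by rewrite ltxx.
  have [mb|bm] := ltP m b; last first.
    rewrite set_itv_ge -?leNgt ?bnd_simp// integral_set0 -phim phi_out ?oppr0//.
    by rewrite /I/= in_itv/= [m < b]ltNge bm andbF.
  rewrite -[LHS]fineK; last first.
    apply: (@integrable_fin_num _ (lebT R)); first exact: borel_lebT.
    exact: leb_continuous_integrable.
  have := leb_FTC2 mb dphiE cdphi; rewrite /Rintegral => ->.
  by rewrite phim (phi_out b) ?sub0r// /I/= in_itv/= ltxx andbF.
have intlt s : leb.-integrable setT (fun t : lebT R => ((s < t)%R%:R * w t)%:E).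
  have -> : (fun t : lebT R => ((s < t)%R%:R * w t)%:E) =
      (fun t => (w t)%:E) \_ (`]s, +oo[%classic : set R).
    apply/funext => t; rewrite patchE mem_setE in_itv/= andbT.
    by case: (s < t); rewrite ?mul1r ?mul0r.
  rewrite -(@integrable_mkcond _ (lebT R)); last exact: borel_lebT.
  by apply: (@integrableS _ (lebT R) _ _ setT) => //; exact: borel_lebT.
have inner s : (\int[leb]_t f (s, t) = (k s * - phi s)%:E)%E.
  rewrite EFinM -tail -integralZl//.
have inner' t : (\int[leb]_s f (s, t) = (w t * v t)%:E)%E.
  have -> : (fun s => f (s, t)) =
      (fun s => (w t)%:E * ((EFin \o k) \_ (`]-oo, t[%classic : set R)) s)%E.
    apply/funext => s; rewrite /f/= patchE mem_setE in_itv/=.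
    by case: (s < t); rewrite ?mul1r ?mul0r ?mulr0 ?mule0// mulrC.
  rewrite integralZl//; last first.
    by rewrite -(@integrable_mkcond _ (lebT R)); [exact: intkS|exact: borel_lebT].
  rewrite -integral_mkcond [in RHS]EFinM /v /Rintegral fineK//.
  apply: (@integrable_fin_num _ (lebT R)); first exact: borel_lebT.
  exact: intkS.
have mf : measurable_fun setT f.
  have id_fst : @measurable_fun _ _ _ (measurableTypeR R) setT
      (fst : lebT R * lebT R -> R).
    by move=> _ A mA; apply: measurable_fst => //; exact: borel_lebT.
  have id_snd : @measurable_fun _ _ _ (measurableTypeR R) setT
      (snd : lebT R * lebT R -> R).
    by move=> _ A mA; apply: measurable_snd => //; exact: borel_lebT.
  have mw : @measurable_fun _ _ (lebT R) (measurableTypeR R) setT w.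
    by have /integrableP[/measurable_EFinP] := intw.
  have mlt : measurable_fun setT
      (fun z : lebT R * lebT R => (z.1 < z.2)%R%:R : R).
    have -> : (fun z : lebT R * lebT R => (z.1 < z.2)%R%:R : R) =
        \1_[set z : lebT R * lebT R | (z.1 < z.2)%R].
      by apply/funext => z; rewrite indicE mem_setE.
    apply: measurable_indic.
    have := measurable_fun_ltr id_fst id_snd.
    have mtrue : measurable [set true] by [].
    move=> /(_ measurableT _ mtrue); rewrite setTI.
    by congr measurable; apply/seteqP; split => z.
  apply/measurable_EFinP; apply: measurable_funM.
    by apply: (measurableT_comp mk); exact: measurable_fst.
  apply: measurable_funM => //.
  by apply: (measurableT_comp mw); exact: measurable_snd.
(* The kernel is dominated by |k(s)| |w(t)|, a product of integrable functions. *)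
have intf : (leb \x leb)%E.-integrable setT f.
  apply/integrable12ltyP => //.
  pose C := (\int[leb]_t `|(w t)%:E|)%E.
  have Cfin : C \is a fin_num.
    by apply: (@integrable_fin_num _ (lebT R)) => //; exact: integrable_abse.
  apply: (@le_lt_trans _ _ (\int[leb]_s (`|(k s)%:E| * C))%E).
    apply: (@le_lower_integral _ (lebT R)) => [s _|s _].
      exact: integral_ge0.
    have mnw : @measurable_fun _ _ (lebT R) _ setT (fun t => `|(w t)%:E|%E).
      by have /integrable_abse/integrableP[] := intw.
    rewrite -(ge0_integralZl leb measurableT mnw)//.
    apply: (@le_lower_integral _ (lebT R)) => // t _.
    rewrite /f/= -EFinM lee_fin !normrM ler_wpM2l//.
    by case: (s < t); rewrite ?normr1 ?normr0 ?mul1r ?mul0r.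
  have mnk : @measurable_fun _ _ (lebT R) _ setT (abse \o (EFin \o k)).
    by have /integrable_abse/integrableP[] := intk.
  have nk0 s : setT s -> (0 <= (abse \o (EFin \o k)) s)%E by move=> _; exact: abse_ge0.
  have C0 : (0 <= C)%E by apply: integral_ge0.
  rewrite (ge0_integralZr leb measurableT mnk nk0 C0).
  rewrite lte_mul_pinfty//.
  - by apply: integral_ge0 => s; exact: nk0.
  - by apply: (@integrable_fin_num _ (lebT R)) => //; exact: integrable_abse.
  - by rewrite -ge0_fin_numE.
have := Fubini intf.
under eq_integral do rewrite inner.
under [X in _ = X]eq_integral do rewrite inner'.
rewrite (_ : (fun s => (k s * - phi s)%:E) =
    (fun s => (- (k s * phi s))%:E) \_ I); last first.
  apply/funext => s; rewrite patchE mulrN.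
  case: ifPn => // /negP sI; rewrite phi_out ?mulr0 ?oppr0//.
  by apply: contra_not sI => /mem_set.
rewrite (_ : (fun t => (w t * v t)%:E) = (fun t => (v t * derive1 phi t)%:E) \_ I).
  rewrite -!integral_mkcond => fub; rewrite -mulN1r -RintegralZl//.
    rewrite /Rintegral -fub; congr fine; apply: eq_integral => s _.
    by rewrite mulN1r.
  apply: leb_integrableM => //; first exact: intkS.
  by move=> t; apply/differentiable_continuous/derivable1_diffP.
apply/funext => t; rewrite patchE /w indicE mulrC mulrA.
by case: ifPn; rewrite ?mulr1 ?mulr0.
Qed.

Lemma W11_primitive (a b : R) : a < b -> exists u : W11 a b,
  W11_deriv u = k /\
  forall t, u t = \int[leb]_(s in (`]-oo, t[%classic : set R)) k s.
Proof.
move=> ab; have intv := leb_continuous_integrable ab primitive_continuous.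
have intkI : leb.-integrable (`]a, b[%classic : set R) (EFin \o k).
  exact: intkS.
exists (Build_W11 (primitive_abs_continuous a b) intv intkI
  (fun phi => @primitive_weak_deriv a b phi ab)).
by split.
Qed.

End primitive.

(** * Weighted one-dimensional energies *)

Section weight.
Context (R : realType) (a b p : R) (ab : a < b) (p_gt1 : 1 < p).
Variable W : R -> R.
Local Notation I := (`]a, b[%classic : set R).
Hypothesis mW : @measurable_fun _ _ (lebT R) (measurableTypeR R) I W.
Hypothesis W_ge0 : forall t, I t -> 0 <= W t.
Let J : \bar R :=
  (\int[leb]_(t in I) neg_powe (W t)%:E (1 / (p - 1)))%E.
Hypothesis J_lty : (J < +oo)%E.

(** A real-valued version of the integrand of [J]. It is 0 rather than +oo where [W] vanishes, which
    by [weight_gt0] happens on a null set only. *)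
Let K (t : R) : R := W t `^ (- (1 / (p - 1))).

Let mI : @measurable _ (lebT R) I.
Proof. exact: borel_lebT. Qed.

Let p1_gt0 : 0 < p - 1.
Proof. by rewrite subr_gt0. Qed.

Let p_gt0 : 0 < p.
Proof. by rewrite (lt_trans ltr01). Qed.

Lemma neg_powe_fin (x r : R) : 0 < x -> neg_powe x%:E r = (x `^ (- r))%:E.
Proof.
by move=> x0; rewrite /neg_powe poweR_EFin inver powRN gt_eqF// powR_gt0.
Qed.

Let neg_powe0 (r : R) : 0 < r -> neg_powe 0%:E r = +oo%E.
Proof. by move=> r0; rewrite /neg_powe poweR_EFin powR0 ?gt_eqF// inve0. Qed.

Let neg_powe_ge0 x (r : R) : (0 <= neg_powe x r)%E.
Proof. by rewrite /neg_powe inve_ge0 poweR_ge0. Qed.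

(** On the zero set of [W] the integrand of [J] is +oo, so positive measure of that set would make
    [J] infinite. *)
Lemma weight_gt0 : {ae leb, forall t : R, I t -> 0 < W t}.
Proof.
pose Z := I `&` W @^-1` [set 0].
have mZ : @measurable _ (lebT R) Z by exact: mW.
exists Z; split => //; last first.
  move=> t /= /not_implyP[It Wt]; split => //=.
  by apply/eqP; have := W_ge0 It; rewrite le_eqVlt => /predU1P[<-//|].
apply: contrapT => /eqP Z0; move: J_lty; apply/negP; rewrite -leNgt.
apply: (@le_trans _ _ (\int[leb]_(t in I) ((cst +oo%E) \_ Z) t)%E).
  rewrite -integral_mkcondr integral_cst; last exact: measurableI.
  rewrite gt0_mulye// lt_neqAle eq_sym measure_ge0 andbT.
  by rewrite setIA setIid.
apply: le_lower_integral => t It; rewrite patchE.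
  by case: ifPn => _ /=; rewrite ?le0y ?lexx.
case: ifPn => // /set_mem [_ /= ->]; rewrite neg_powe0//.
by rewrite divr_gt0.
Qed.

Let WK : {ae leb, forall t : R, I t ->
  neg_powe (W t)%:E (1 / (p - 1)) = (K t)%:E}.
Proof. by move: weight_gt0; apply: filterS => t Wt It; rewrite neg_powe_fin// Wt. Qed.

Lemma weight_integralE : J = (\int[leb]_(t in I) (K t)%:E)%E.
Proof.
apply/eqP; rewrite eq_le; apply/andP; split; apply: ae_le_lower_integral => //.
- by move=> t _; rewrite lee_fin powR_ge0.
- by move: WK; apply: filterS => t Wt It; rewrite Wt.
- by move=> t _; rewrite lee_fin powR_ge0.
- by move: WK; apply: filterS => t Wt It; rewrite Wt.
Qed.

Let mK : @measurable_fun _ _ (lebT R) _ I K.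
Proof.
have mW' : @measurable_fun _ _ (lebT R) _ I W by exact: mW.
by apply: (measurableT_comp (@measurable_powR R _) mW').
Qed.

Lemma weight_integrable : leb.-integrable I (EFin \o K).
Proof.
apply/integrableP; split; first exact/measurable_EFinP.
rewrite (_ : (\int[leb]_(t in I) `|(EFin \o K) t|)%E = J) //.
rewrite weight_integralE; apply: eq_integral => t _.
by rewrite gee0_abs// lee_fin powR_ge0.
Qed.

(** Otherwise [K] vanishes almost everywhere, but it is positive wherever [W] is, and ]a, b[ is not
    null. *)
Lemma weight_integral_gt0 : (0 < J)%E.
Proof.
rewrite lt_neqAle integral_ge0 ?andbT; last by move=> t _; exact: neg_powe_ge0.
apply/negP => /eqP J0.
have : (\int[leb]_(t in I) `|(K t)%:E|)%E = 0%E.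
  rewrite J0 weight_integralE; apply: eq_integral => t _.
  by rewrite gee0_abs// lee_fin powR_ge0.
have mKE : @measurable_fun _ _ (lebT R) _ I (EFin \o K).
  exact/measurable_EFinP.
move=> /(ae_eq_integral_abs _ mI mKE) K0.
have [N [mN N0 IN]] : {ae leb, forall t : R, ~ I t}.
  move: K0 weight_gt0; apply: filterS2 => t Kt Wt It.
  have [Kt0] := Kt It; have := powR_gt0 (- (1 / (p - 1))) (Wt It).
  by rewrite -/(K t) Kt0 ltxx.
have : (leb I <= leb N)%E.
  by apply: le_measure; rewrite ?inE// => t It; apply: IN => /= /(_ It).
rewrite N0 (leb_itv _ _ (ltW ab)) => ba0.
have : (0%:E < (b - a)%:E)%E by rewrite lte_fin subr_gt0.
by rewrite ltNge ba0.
Qed.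

Lemma weight_integral_fin_num : J \is a fin_num.
Proof. by rewrite ge0_fin_numE// ltW// weight_integral_gt0. Qed.

(** The first identity is the Euler-Lagrange equation: the flux |v'|^(p-1) W is constant when v' is
    a multiple of [K]. *)
Lemma weight_powE (t : R) : 0 < W t ->
  K t `^ (p - 1) * W t = 1 /\ K t `^ p * W t = K t.
Proof.
move=> Wt; have K1 : K t `^ (p - 1) * W t = 1.
  rewrite /K -powRrM mulNr mul1r mulVf ?gt_eqF// powR_inv1 ?ltW//.
  by rewrite mulVf// gt_eqF.
split => //; rewrite -[in LHS](subrK 1 p) powRD; last first.
  by apply/implyP => _; rewrite gt_eqF// powR_gt0.
by rewrite powRr1 ?powR_ge0// mulrAC K1 mul1r.
Qed.

Lemma neg_powe_weight_integral :
  neg_powe J (p - 1) = (fine J `^ (1 - p))%:E.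
Proof.
rewrite -{1}[J]fineK ?weight_integral_fin_num// neg_powe_fin ?opprB//.
by rewrite fine_gt0// weight_integral_gt0.
Qed.

Lemma weight_energy_lower (g : R -> R) (A : R -> \bar R) :
  leb.-integrable I (EFin \o g) -> 1 <= \int[leb]_(t in I) g t ->
  (forall t, 0 <= A t)%E ->
  {ae leb, forall t : R, I t -> ((W t)%:E <= A t)%E} ->
  (neg_powe J (p - 1) <= \int[leb]_(t in I) ((`|g t| `^ p)%:E * A t))%E.
Proof.
move=> intg g1 A0 WA.
have j0 : 0 < fine J by rewrite fine_gt0// weight_integral_gt0// J_lty.
set j := fine J in j0; rewrite neg_powe_weight_integral -/j.
have mg : @measurable_fun _ _ (lebT R) _ I g.
  by have /integrableP[/measurable_EFinP] := intg.
have mW' : @measurable_fun _ _ (lebT R) _ I W by exact: mW.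
(* Replacing [A] by [W] first leaves measurable integrands, for which the integral is additive. *)
apply: (@le_trans _ _ (\int[leb]_(t in I) (`|g t| `^ p * W t)%:E)%E); last first.
  apply: ae_le_lower_integral.
  - by move=> t It; rewrite lee_fin mulr_ge0 ?powR_ge0// W_ge0.
  - by move=> t _; rewrite mule_ge0// lee_fin powR_ge0.
  - move: WA; apply: filterS => t WA It; rewrite EFinM lee_wpmul2l ?lee_fin ?powR_ge0//.
    exact: WA.
pose c := j^-1; have c0 : 0 < c by rewrite invr_gt0.
pose cp := c `^ (p - 1); have cp0 : 0 < cp by rewrite powR_gt0.
have cpE : c `^ p = cp * c.
  rewrite -[X in c `^ X](subrK 1 p) powRD ?powRr1 ?ltW//.
  by apply/implyP => _; rewrite gt_eqF.
have -> : j `^ (1 - p) = cp.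
  by rewrite /cp /c -powR_inv1 ?ltW// -powRrM mulN1r opprB.
(* Young's inequality with [K = W^(-1/(p-1))]: the tangent line of
   [x |-> x^p W] at the optimal value [x = c K]. *)
have young x t : 0 <= x -> 0 < W t ->
    p * cp * x <= x `^ p * W t + (p - 1) * c `^ p * K t.
  move=> x0 Wt; have [K1 Kp] := weight_powE Wt.
  have K0 : 0 <= K t by exact: powR_ge0.
  pose q := p / (p - 1).
  have q0 : 0 < q by rewrite divr_gt0.
  have pq : p^-1 + q^-1 = 1 by rewrite invf_div; field; rewrite gt_eqF.
  (* The second factor (c K)^(p-1) has q-th power (c K)^p; multiplying by [p * W t] then clears the
     denominators, and [weight_powE] removes [W]. *)
  have := @conjugate_powR _ x ((c * K t) `^ (p - 1)) p q x0 (powR_ge0 _ _)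
    p_gt0 q0 pq.
  rewrite -powRrM (_ : (p - 1) * q = p); last first.
    by rewrite /q mulrC divfK// gt_eqF.
  rewrite !powRM ?(ltW c0)// -/cp => Y.
  have {Y} : (x * (cp * K t `^ (p - 1))) * (p * W t) <=
      (x `^ p / p + c `^ p * K t `^ p / q) * (p * W t).
    by rewrite ler_wpM2r// mulr_ge0// ltW.
  have -> : (x * (cp * K t `^ (p - 1))) * (p * W t) =
      p * cp * x * (K t `^ (p - 1) * W t) by ring.
  have -> : (x `^ p / p + c `^ p * K t `^ p / q) * (p * W t) =
      x `^ p * W t + (p - 1) * c `^ p * (K t `^ p * W t).
    by rewrite /q; field; rewrite !gt_eqF.
  by rewrite K1 Kp mulr1.
have mgW : @measurable_fun _ _ (lebT R) _ I (fun t => (`|g t| `^ p * W t)%:E).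
  have mgn : @measurable_fun _ _ (lebT R) R I (fun t => `|g t|).
    exact: (measurableT_comp (@normr_measurable R setT) mg).
  have mgp : @measurable_fun _ _ (lebT R) R I (fun t => `|g t| `^ p).
    exact: (measurableT_comp (@measurable_powR R p) mgn).
  exact/measurable_EFinP/(measurable_funM mgp mW').
have mKc : @measurable_fun _ _ (lebT R) _ I
    (fun t => ((p - 1) * c `^ p * K t)%:E).
  by apply/measurable_EFinP; exact: measurable_funM.
have intK : (\int[leb]_(t in I) (K t)%:E = j%:E)%E.
  by rewrite -weight_integralE /j fineK// weight_integral_fin_num.
have : (\int[leb]_(t in I) (p * cp * `|g t|)%:E <=
    \int[leb]_(t in I) (`|g t| `^ p * W t)%:E + ((p - 1) * cp)%:E)%E.
  have -> : ((p - 1) * cp)%:E =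
      (\int[leb]_(t in I) ((p - 1) * c `^ p * K t)%:E)%E.
    under eq_integral do rewrite EFinM.
    have mKE : @measurable_fun _ _ (lebT R) (\bar R) I (fun t => (K t)%:E).
      exact/measurable_EFinP.
    have KE0 (t : lebT R) : I t -> (0 <= (K t)%:E)%E.
      by move=> _; rewrite lee_fin powR_ge0.
    rewrite (ge0_integralZl_EFin leb mI KE0 mKE); last first.
      by rewrite mulr_ge0 ?powR_ge0// ltW.
    by rewrite intK -EFinM cpE /c mulrA mulfVK ?gt_eqF.
  rewrite -ge0_integralD//; last 2 first.
  - by move=> t It; rewrite lee_fin mulr_ge0 ?powR_ge0// W_ge0.
  - by move=> t It; rewrite lee_fin mulr_ge0 ?powR_ge0// mulr_ge0 ?powR_ge0// ltW.
  apply: ae_le_lower_integral.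
  - by move=> t It; rewrite lee_fin !mulr_ge0// ltW.
  - move=> t It; rewrite -EFinD lee_fin addr_ge0//.
      by rewrite mulr_ge0 ?powR_ge0// W_ge0.
    by rewrite mulr_ge0 ?powR_ge0// mulr_ge0 ?powR_ge0// ltW.
  - move: weight_gt0; apply: filterS => t Wt It.
    by rewrite -EFinD lee_fin young// Wt.
move=> total.
have intng : leb.-integrable I (fun t => (`|g t|)%:E) by exact: integrable_norm.
have ng1 : (1 <= \int[leb]_(t in I) (`|g t|)%:E)%E.
  rewrite -(fineK (integrable_fin_num mI intng)) lee_fin.
  apply: (le_trans g1); apply: le_trans (ler_norm _) _.
  exact: le_normr_Rintegral.
have : ((p * cp)%:E <=
    \int[leb]_(t in I) (`|g t| `^ p * W t)%:E + ((p - 1) * cp)%:E)%E.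
  apply: le_trans total; under eq_integral do rewrite EFinM.
  have mng : @measurable_fun _ _ (lebT R) (\bar R) I (fun t => (`|g t|)%:E).
    by have /integrableP[] := intng.
  have ng0 (t : lebT R) : I t -> (0 <= (`|g t|)%:E)%E by rewrite lee_fin.
  rewrite (ge0_integralZl_EFin leb mI ng0 mng); last by rewrite mulr_ge0// ltW.
  by rewrite -[leLHS]mule1 lee_wpmul2l// lee_fin mulr_ge0// ltW.
(* p cp - (p - 1) cp = cp; only a finite constant is moved across, so the energy may be infinite. *)
rewrite -leeBlDr// -EFinB; apply: le_trans.
by rewrite lee_fin; lra.
Qed.

Lemma weight_energy_upper (A : R -> \bar R) : (forall t, 0 <= A t)%E ->
  {ae leb, forall t : R, I t -> (A t <= (W t)%:E)%E} ->
  exists v : W11 a b, [/\ v a = 0, v b = 1 &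
    (\int[leb]_(t in I) ((`|W11_deriv v t| `^ p)%:E * A t)
      <= neg_powe J (p - 1))%E].
Proof.
move=> A0 AW.
have j0 : 0 < fine J by rewrite fine_gt0// weight_integral_gt0// J_lty.
set j := fine J in j0; rewrite neg_powe_weight_integral -/j.
pose c := j^-1; have c0 : 0 < c by rewrite invr_gt0.
(* Cut off outside [I], so that its primitive from -oo is 0 at [a] and 1 at [b]. *)
pose k := (fun t => c * K t) \_ I.
have kE : EFin \o k = (fun t => (c * K t)%:E) \_ I.
  by apply/funext => t; rewrite /k /= !patchE; case: ifPn.
have intcK : leb.-integrable I (fun t => (c * K t)%:E).
  by have := integrableZl mI c weight_integrable; apply.
have intk : leb.-integrable setT (EFin \o k).
  by rewrite kE -(@integrable_mkcond _ (lebT R)).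
have intKj : (\int[leb]_(t in I) (c * K t)%:E = 1)%E.
  under eq_integral do rewrite EFinM.
  rewrite integralZl//; last exact: weight_integrable.
  rewrite -weight_integralE -[J]fineK ?weight_integral_fin_num//.
  by rewrite -EFinM mulVf// gt_eqF.
have [v [v'E vE]] := W11_primitive intk ab.
have vI t : v t =
    fine (\int[leb]_(s in (`]-oo, t[%classic : set R) `&` I) (c * K s)%:E)%E.
  by rewrite vE /Rintegral -[X in integral _ _ X]/(EFin \o k) kE integral_mkcondr.
exists v; split.
- rewrite vI (_ : _ `&` _ = set0) ?integral_set0//.
  apply/seteqP; split => // s [] /=; rewrite !in_itv/= => sa /andP[as_ _].
  by have := lt_trans sa as_; rewrite ltxx.
- rewrite vI setIidr ?intKj//.
  by move=> s /=; rewrite !in_itv/= => /andP[].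
- rewrite v'E.
  (* Where [W > 0], (c K)^p W = c^p K; the integral of the latter is c^p J = J^(1-p). *)
  apply: (@le_trans _ _ (\int[leb]_(t in I) ((c `^ p)%:E * (K t)%:E))%E).
    apply: ae_le_lower_integral.
    + by move=> t It; rewrite mule_ge0// lee_fin powR_ge0.
    + by move=> t It; rewrite mule_ge0// lee_fin powR_ge0.
    + move: AW weight_gt0; apply: filterS2 => t AWt Wt It.
      apply: (le_trans (lee_wpmul2l _ (AWt It))); first by rewrite lee_fin powR_ge0.
      have [_ KW] := weight_powE (Wt It).
      rewrite -!EFinM lee_fin /k patchE mem_set// ger0_norm.
        by rewrite (powRM _ (ltW c0) (powR_ge0 _ _)) -mulrA KW.
      by rewrite mulr_ge0 ?powR_ge0// ltW.
  rewrite integralZl//; last exact: weight_integrable.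
  rewrite -weight_integralE -[J]fineK ?weight_integral_fin_num// -/j.
  rewrite -EFinM lee_fin /c -(powR_inv1 (ltW j0)) -powRrM mulN1r.
  rewrite -[X in _ * X <= _](powRr1 (ltW j0)) -powRD; last first.
    by apply/implyP => _; rewrite gt_eqF.
  by rewrite [- p + 1]addrC.
Qed.

End weight.

(** * Bounds of the capacity *)

Lemma lebesgue_measurable_weight (R : realType) (a b r : R) (G S : R -> R) :
  lebesgue_measurable_fun `[a, b] G -> lebesgue_measurable_fun `[a, b] S ->
  @measurable_fun _ _ (lebT R) (measurableTypeR R) (`]a, b[%classic : set R)
    (fun t => G t `^ r * S t).
Proof.
move=> mG mS.
have mGS : @measurable_fun _ _ (lebT R) _ (`[a, b]%classic : set R)
    (fun t => G t `^ r * S t).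
  apply: measurable_funM => //.
  exact: (measurableT_comp (@measurable_powR R _)).
apply: (@measurable_funS _ _ (lebT R) _ (`[a, b]%classic : set R)) => //.
- exact: borel_lebT.
- by apply: subset_itv; rewrite bnd_simp.
Qed.

Lemma energy_weight_ge0 (R : realType) n (p : R) (Omega : set 'rV[R]_n) theta t :
  (0 <= energy_weight p Omega theta t)%E.
Proof. by apply: integral_ge0 => x _; rewrite lee_fin powR_ge0. Qed.

Theorem proposition4p1 (R : realType) (n : nat) (n_gt0 : (0 < n)%N)
    (Omega : set 'rV[R]_n) (Omega_open : open Omega)
    (Omega_bounded : bounded_set Omega)
    (p : R) (p_gt1 : 1 < p)
    (theta : 'rV[R]_n -> R)
    (theta_lipschitz : [lipschitz theta x | x in closure Omega])
    (a b : R) (ab : a < b)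
    (Gm Gp m M : R -> R)
    (Gm_meas : lebesgue_measurable_fun `[a, b] Gm)
    (Gp_meas : lebesgue_measurable_fun `[a, b] Gp)
    (m_meas : lebesgue_measurable_fun `[a, b] m)
    (M_meas : lebesgue_measurable_fun `[a, b] M)
    (Gm_ge0 : forall t, t \in `[a, b] -> 0 <= Gm t)
    (Gp_ge0 : forall t, t \in `[a, b] -> 0 <= Gp t)
    (m_ge0 : forall t, t \in `[a, b] -> 0 <= m t)
    (M_ge0 : forall t, t \in `[a, b] -> 0 <= M t)
    (gradient_bounds :
      ae_in [set x | Omega x /\ a <= theta x <= b]
            [set x | Gm (theta x) <= enorm (gradient theta x) <= Gp (theta x)])
    (area_bounds : {ae leb, forall t : R, t \in `]a, b[ ->
      ((m t)%:E <= level_area Omega theta t <= (M t)%:E)%E}) :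
  [/\ {ae leb, forall t : R, t \in `]a, b[ ->
        ((Gm t `^ (p - 1) * m t)%:E <= energy_weight p Omega theta t
         <= (Gp t `^ (p - 1) * M t)%:E)%E},
      (\int[leb]_(t in `]a, b[)
          neg_powe (Gm t `^ (p - 1) * m t)%:E (1 / (p - 1)) < +oo)%E ->
      (neg_powe (\int[leb]_(t in `]a, b[)
          neg_powe (Gm t `^ (p - 1) * m t)%:E (1 / (p - 1))) (p - 1)
        <= capacity p Omega theta a b)%E
    & (\int[leb]_(t in `]a, b[)
          neg_powe (Gp t `^ (p - 1) * M t)%:E (1 / (p - 1)) < +oo)%E ->
      (capacity p Omega theta a b
        <= neg_powe (\int[leb]_(t in `]a, b[)
          neg_powe (Gp t `^ (p - 1) * M t)%:E (1 / (p - 1))) (p - 1))%E].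
Proof.
have weights := energy_weight_bounds n_gt0 p_gt1 Omega_open theta_lipschitz
  Gm_ge0 gradient_bounds area_bounds.
have I_itv t : t \in `]a, b[ -> t \in `[a, b].
  by rewrite !in_itv/= => /andP[/ltW -> /ltW ->].
split; [exact: weights| |] => J_lty.
- have W_ge0 t : t \in `]a, b[ -> 0 <= Gm t `^ (p - 1) * m t.
    by move=> /I_itv tab; rewrite mulr_ge0 ?powR_ge0 ?m_ge0.
  apply: le_ereal_inf_tmp => _ [v [va vb _] <-].
  have mW := lebesgue_measurable_weight (p - 1) Gm_meas m_meas.
  apply: (weight_energy_lower ab p_gt1 mW W_ge0 J_lty
    (A := energy_weight p Omega theta)).
  + exact: W11_deriv_integrable.
  + by rewrite W11_FTC// va vb subr0.
  + by move=> t; exact: energy_weight_ge0.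
  + by move: weights; apply: filterS => t wt tab; have /andP[] := wt tab.
- have W_ge0 t : t \in `]a, b[ -> 0 <= Gp t `^ (p - 1) * M t.
    by move=> /I_itv tab; rewrite mulr_ge0 ?powR_ge0 ?M_ge0.
  have mW := lebesgue_measurable_weight (p - 1) Gp_meas M_meas.
  have [v [va vb Ev]] := weight_energy_upper ab p_gt1 mW W_ge0 J_lty
    (energy_weight_ge0 p Omega theta)
    (filterS (fun t wt tab => proj2 (andP (wt tab))) weights).
  apply: (le_trans _ Ev); apply: ereal_inf_lbound; exists v => //.
  (* Admissibility demands finite energy; the bound J^(1-p) is a real number because 0 < J < +oo. *)
  split => //; apply: (le_lt_trans Ev).
  by rewrite (neg_powe_weight_integral ab p_gt1 mW W_ge0 J_lty) ltry.
Qed.
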